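(* Let $S\subset\mathbb F_q^1[X]$. If $\overline d_q(S)>0$, then there exists $E_S\subset E$ such that \[\dim_{\rm H}E_S=\dim_{\rm H}E=\frac12,\qquad \overline d_q\left(\bigcup_{n\in\mathbb N}\bigcap_{x\in E_S}\{A_n(x)\}\cap S\right)=\overline d_q(S),\] and \[\overline d\left(\bigcup_{n\in\mathbb N}\bigcap_{x\in E_S}\{\deg A_n(x)\}\cap\deg(S)\right)=\overline d(\deg(S)).\] In particular, the Hausdorff dimension of the set of all $x\in E$ satisfying both $\overline d_q(\{A_n(x)\colon n\in\mathbb N\}\cap S)=\overline d_q(S)$ and $\overline d(\{\deg A_n(x)\colon n\in\mathbb N\}\cap\deg(S))=\overline d(\deg(S))$ equals $\dim_{\rm H}E$.
   Context: $\mathbb F_q$ is a finite field with $q$ elements, and $\mathbb F_q((X^{-1}))$ is the field of formal Laurent series $x=\sum_{i=n_0}^\infty c_iX^{-i}$ ($n_0\in\mathbb Z$, $c_i\in\mathbb F_q$). For $x\ne 0$, $\deg x=-\inf\{n\in\mathbb Z\colon c_n\ne 0\}$ and $\|x\|_q=q^{\deg x}$; $\|0\|_q=0$. $\mathbb F_q(X)$ (rational functions) is regarded as a subfield of $\mathbb F_q((X^{-1}))$ via expansion at infinity. The integral part is $[x]=\sum_{i=n_0}^0c_iX^{-i}\in\mathbb F_q[X]$. Let $\Delta=\{x\in\mathbb F_q((X^{-1}))\colon\|x\|_q<1\}$, with metric $\|x-y\|_q$; $\dim_{\rm H}$ is the Hausdorff dimension on $\Delta$ for this metric. $\mathbb N=\{1,2,\dots\}$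 and $\mathbb F_q^1[X]=\{A\in\mathbb F_q[X]\colon\deg A\ge 1\}$. Define $T\colon\Delta\to\Delta$ by $T(x)=1/x-[1/x]$ for $x\neq0$ and $T(0)=0$. For $n\ge1$ the $n$th digit of $x\in\Delta$ is $A_n(x)=[1/T^{n-1}(x)]\in\mathbb F_q^1[X]$, defined if $T^{n-1}(x)\ne0$. Every $x\in\Delta\setminus\mathbb F_q(X)$ has all digits defined and has the unique infinite continued fraction expansion $x=1/(A_1(x)+1/(A_2(x)+\cdots))$. $E=\{x\in\Delta\setminus\mathbb F_q(X)\colon A_m(x)\ne A_n(x)\text{ for all }m\ne n\}$. For $S\subset\mathbb F_q^1[X]$ and $N\in\mathbb N$, $Q_N(S)=\{A\in S\colon\deg A\le N\}$, $\deg(S)=\{\deg A\colon A\in S\}\subset\mathbb N$, and $\overline d_q(S)=\limsup_{N\to\infty}\#Q_N(S)/\#Q_N(\mathbb F_q^1[X])$. For $B\subset\mathbb N$, $\overline d(B)=\limsup_{N\to\infty}\#(B\cap[1,N])/N$. The set $\bigcap_{x\in E_S}\{A_n(x)\}$ is $\{A\}$ if $A_n(x)=A$ for every $x\in E_S$, and is empty if $A_n$ is not constant on $E_S$; similarly for $\deg A_n(x)$. *)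

(* Defs.v *)
From HB Require Import structures.
From mathcomp Require Import all_boot all_order all_algebra.
From mathcomp Require Import finmap zify.
From mathcomp Require Import all_classical all_reals all_analysis.

Set Implicit Arguments.
Unset Strict Implicit.
Unset Printing Implicit Defensive.

Import Order.TTheory GRing.Theory Num.Theory.

Local Open Scope classical_set_scope.
Local Open Scope ring_scope.

(* [x n] is the coefficient c_n of X^-n in x = \sum_n c_n X^-n. *)
Record laurent (F : fieldType) := Laurent {
  lcoef :> int -> F;
  lcoefP : exists n0 : int, forall n, n < n0 -> lcoef n = 0 }.

Lemma le_intD (m n : int) : m <= n -> exists k : nat, n = m + k%:Z.
Proof. by move=> mn; exists `|n - m|%N; lia. Qed.

Section LaurentField.
Context {F : fieldType}.
Implicit Types x y z : laurent F.

Lemma laurent_ext x y : (forall n, x n = y n) -> x = y.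
Proof.
case: x => f fP; case: y => g gP /= /funext fg.
by case: _ / fg gP => gP; congr Laurent; exact: Prop_irrelevance.
Qed.

HB.instance Definition _ := gen_eqMixin (laurent F).
HB.instance Definition _ := gen_choiceMixin (laurent F).

Lemma lzero_subproof : exists n0 : int, forall n, n < n0 -> (0 : F) = 0.
Proof. by exists 0. Qed.
Definition lzero := Laurent lzero_subproof.

Lemma ladd_subproof x y :
  exists n0 : int, forall n, n < n0 -> x n + y n = 0.
Proof.
have [a ha] := lcoefP x; have [b hb] := lcoefP y.
exists (Num.min a b) => n; rewrite lt_min => /andP[na nb].
by rewrite ha// hb// addr0.
Qed.
Definition ladd x y := Laurent (ladd_subproof x y).

Lemma lopp_subproof x : exists n0 : int, forall n, n < n0 -> - x n = 0.
Proof. by have [a ha] := lcoefP x; exists a => n /ha ->; rewrite oppr0. Qed.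
Definition lopp x := Laurent (lopp_subproof x).

Lemma laddA : associative ladd.
Proof. by move=> x y z; apply: laurent_ext => n /=; rewrite addrA. Qed.
Lemma laddC : commutative ladd.
Proof. by move=> x y; apply: laurent_ext => n /=; rewrite addrC. Qed.
Lemma ladd0 : left_id lzero ladd.
Proof. by move=> x; apply: laurent_ext => n /=; rewrite add0r. Qed.
Lemma laddN : left_inverse lzero lopp ladd.
Proof. by move=> x; apply: laurent_ext => n /=; rewrite addNr. Qed.

HB.instance Definition _ :=
  GRing.isZmodule.Build (laurent F) laddA laddC ladd0 laddN.

(* Cauchy product; for each n only finitely many terms are nonzero. *)
Definition lmul_coef x y (n : int) : F :=
  \sum_(i \in [set: int]) (x i * y (n - i)).

Lemma lmul_coefE x y (a b n : int) (N : nat) :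
  (forall i, i < a -> x i = 0) -> (forall i, i < b -> y i = 0) ->
  n - a - b < N%:Z ->
  lmul_coef x y n = \sum_(k < N) x (a + k%:Z) * y (n - (a + k%:Z)).
Proof.
move=> ha hb hN.
pose r := [seq a + k%:Z | k <- iota 0 N].
rewrite /lmul_coef -(fsbig_widen [set` r] [set: int])//; last first.
  move=> i [_ /= /negP ir]; have [ia|ai] := ltP i a; first by rewrite ha// mul0r.
  rewrite hb ?mulr0//; rewrite ltNge; apply: contra ir => bi.
  apply/mapP; exists `|i - a|%N; last by lia.
  by rewrite mem_iota; lia.
rewrite -fsbig_seq; last first.
  by rewrite map_inj_uniq ?iota_uniq// => k l; lia.
by rewrite /r big_map -[N in iota 0 N]subn0 -/(index_iota 0 N) big_mkord.
Qed.

Lemma lmul_coef0 x y (a b n : int) :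
  (forall i, i < a -> x i = 0) -> (forall i, i < b -> y i = 0) ->
  n < a + b -> lmul_coef x y n = 0.
Proof.
move=> ha hb nab; rewrite (@lmul_coefE x y a b n 0)// ?big_ord0//; lia.
Qed.

Lemma lmul_subproof x y :
  exists n0 : int, forall n, n < n0 -> lmul_coef x y n = 0.
Proof.
have [a ha] := lcoefP x; have [b hb] := lcoefP y.
by exists (a + b) => n; exact: lmul_coef0.
Qed.
Definition lmul x y := Laurent (lmul_subproof x y).

Lemma lone_subproof :
  exists n0 : int, forall n, n < n0 -> (n == 0)%:R = 0 :> F.
Proof. by exists 0 => n n0; rewrite lt_eqF. Qed.
Definition lone := Laurent lone_subproof.

Definition ltrunc (a : int) (N : nat) x : {poly F} :=
  \poly_(k < N) x (a + k%:Z).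

Lemma lmul_ltrunc x y (a b : int) (N k : nat) :
  (forall i, i < a -> x i = 0) -> (forall i, i < b -> y i = 0) ->
  (k < N)%N ->
  lmul x y (a + b + k%:Z) = (ltrunc a N x * ltrunc b N y)`_k.
Proof.
move=> ha hb kN; rewrite /= (@lmul_coefE x y a b _ k.+1)//; last by lia.
rewrite coefM; apply: eq_bigr => -[j /= jk] _; rewrite !coef_poly.
rewrite !ifT; [|lia|lia].
by congr (_ * y _); lia.
Qed.

Lemma lmulC : commutative lmul.
Proof.
move=> x y; have [a ha] := lcoefP x; have [b hb] := lcoefP y.
apply: laurent_ext => n; have [nab|abn] := ltP n (a + b).
  by rewrite /= (lmul_coef0 ha hb)// (lmul_coef0 hb ha)//; lia.
have [k ->] := le_intD abn.
rewrite (lmul_ltrunc ha hb (ltnSn _)) mulrC [a + b]addrC.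
by rewrite -(lmul_ltrunc hb ha (ltnSn _)).
Qed.

Lemma lmulA : associative lmul.
Proof.
move=> x y z; have [a ha] := lcoefP x; have [b hb] := lcoefP y.
have [c hc] := lcoefP z.
have hab n : n < a + b -> lmul x y n = 0 by exact: lmul_coef0.
have hbc n : n < b + c -> lmul y z n = 0 by exact: lmul_coef0.
apply: laurent_ext => n; have [nabc|abcn] := ltP n (a + (b + c)).
  rewrite [LHS](lmul_coef0 ha hbc)// [RHS](lmul_coef0 hab hc)//; lia.
have [k ->] := le_intD abcn; set N := k.+1.
rewrite (lmul_ltrunc ha hbc (ltnSn _)) addrA.
rewrite (lmul_ltrunc hab hc (ltnSn _)) -/N.
transitivity ((ltrunc a N x * (ltrunc b N y * ltrunc c N z))`_k).
  rewrite !coefM; apply: eq_bigr => -[j /= jk] _; congr (_ * _).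
  rewrite [LHS]coef_poly ifT; last by lia.
  by rewrite (@lmul_ltrunc _ _ _ _ N)//; lia.
rewrite mulrA [LHS]coefM [RHS]coefM; apply: eq_bigr => -[j /= jk] _.
congr (_ * _); rewrite [RHS]coef_poly ifT; last by lia.
by rewrite (@lmul_ltrunc _ _ _ _ N)//; lia.
Qed.

Lemma lmul1 : left_id lone lmul.
Proof.
move=> x; have [a ha] := lcoefP x; apply: laurent_ext => n /=.
have h0 i : i < 0 -> lone i = 0 by move=> i0; rewrite /= lt_eqF.
have [na|an] := ltP n a; first by rewrite (lmul_coef0 h0 ha) ?ha//; lia.
rewrite (@lmul_coefE _ _ 0 a n (`|n - a|%N).+1)//; last by lia.
rewrite big_ord_recl big1 /=.
  by rewrite !addr0 mul1r.
by move=> i _; rewrite mul0r.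
Qed.

Lemma lmulDl : left_distributive lmul ladd.
Proof.
move=> x y z; have [a1 h1] := lcoefP x; have [a2 h2] := lcoefP y.
have [c hc] := lcoefP z; pose a := Num.min a1 a2.
have hx i : i < a -> x i = 0 by rewrite lt_min => /andP[/h1].
have hy i : i < a -> y i = 0 by rewrite lt_min => /andP[_ /h2].
have hxy i : i < a -> ladd x y i = 0.
  by move=> ia; rewrite /= hx// hy// addr0.
apply: laurent_ext => n /=.
have [N nN] : exists N : nat, n - a - c < N%:Z by exists (`|(n - a - c)%R|%N).+1; lia.
rewrite (lmul_coefE hxy hc nN) (lmul_coefE hx hc nN) (lmul_coefE hy hc nN).
by rewrite -big_split; apply: eq_bigr => i _ /=; rewrite mulrDl.
Qed.

Lemma lone_neq0 : lone != 0.
Proof.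
by apply/eqP => /(congr1 (fun x => lcoef x 0)) /= /eqP; rewrite oner_eq0.
Qed.

HB.instance Definition _ := GRing.Zmodule_isComNzRing.Build (laurent F)
  lmulA lmulC lmul1 lmulDl lone_neq0.

Definition is_lorder x (v : int) :=
  x v != 0 /\ forall m, m < v -> x m = 0.

Lemma ex_lorder x : x != 0 -> exists v, is_lorder x v.
Proof.
move=> x0; have [a ha] := lcoefP x.
have [k xk] : exists k : nat, x (a + k%:Z) != 0.
  apply: contrapT => /forallNP h; move/eqP: x0; apply.
  apply: laurent_ext => n /=; have [/ha//|an] := ltP n a.
  have -> : n = a + `|n - a|%N%:Z by lia.
  by apply/eqP/negPn/negP; exact: h.
have [m xm mmin] := @ex_minnP (fun k : nat => x (a + k%:Z) != 0) (ex_intro _ k xk).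
exists (a + m%:Z); split => // i im; have [/ha//|ai] := ltP i a.
have -> : i = a + `|i - a|%N%:Z by lia.
apply/eqP/negPn/negP => /mmin; lia.
Qed.

Fixpoint linv_seq (g : nat -> F) (n : nat) : seq F :=
  if n is m.+1 then
    let s := linv_seq g m in
    (- (g 0)^-1 * \sum_(j < m.+1) g j.+1 * s`_j) :: s
  else [:: (g 0)^-1].

Lemma linv_seqE g n j :
  (j <= n)%N -> (linv_seq g n)`_j = (linv_seq g (n - j))`_0.
Proof.
elim: n j => [|n IHn] [|j]//= jn.
by rewrite IHn.
Qed.

Lemma ex_linv x : x != 0 -> exists y, x * y = 1.
Proof.
move=> /ex_lorder[v [xv hv]]; pose g (k : nat) := x (v + k%:Z).
pose u n := (linv_seq g n)`_0.
pose f (n : int) := if n + v is Posz m then u m else 0.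
have fP n : n < - v -> f n = 0.
  by rewrite /f; case E : (n + v) => //; lia.
have fPe : exists n0, forall n, n < n0 -> f n = 0 by exists (- v).
exists (Laurent fPe); apply: laurent_ext => n.
have [n0|n0] := ltP n 0.
  rewrite [LHS](lmul_coef0 hv (y := Laurent fPe) fP); last by lia.
  by rewrite /= lt_eqF.
have -> : n = v + (- v) + `|n|%N%:Z by lia.
rewrite (@lmul_ltrunc x (Laurent fPe) _ _ _ _ hv fP (ltnSn _)) coefM subrr add0r.
have fE m : f (- v + m%:Z) = u m by rewrite /f addrAC addNr add0r.
have g0 : g 0%N = x v by rewrite /g addr0.
set k := `|n|%N; transitivity (\sum_(j < k.+1) g j * u (k - j)%N).
  apply: eq_bigr => -[j /= jk] _; rewrite !coef_poly !ifT; [|lia|lia].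
  by congr (_ * _); exact: fE.
case: k => [|k].
  by rewrite big_ord1 /u /= g0 divff// eqxx.
rewrite big_ord_recl /u /= mulrA mulrN g0 divff// mulN1r.
rewrite [X in _ + X](_ : _ = \sum_(j < k.+1) g j.+1 * (linv_seq g k)`_j).
  by rewrite addNr.
by apply: eq_bigr => -[j /= jk] _; rewrite [in RHS]linv_seqE.
Qed.

Definition linv x : laurent F := xget 0 [set y | x * y = 1].

Lemma lmulVx x : x != 0 -> linv x * x = 1.
Proof. by move=> /ex_linv h; rewrite mulrC; exact: (xgetPex 0 h). Qed.

Lemma linv0 : linv 0 = 0.
Proof.
apply: xgetPN => y /eqP; rewrite mul0r eq_sym; exact/negP/oner_neq0.
Qed.

HB.instance Definition _ :=
  GRing.ComNzRing_isField.Build (laurent F) lmulVx linv0.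

(* deg x = - inf {n | c_n != 0}, with junk value 0 at x = 0 *)
Definition ldeg x : int := - xget 0 (is_lorder x).

Lemma ldegP x : x != 0 -> is_lorder x (- ldeg x).
Proof. by move=> /ex_lorder h; rewrite opprK; exact: (xgetPex 0 h). Qed.

(* The integral part [x] = \sum_(n <= 0) c_n X^-n.  The coefficients of X^j
   with j > |deg x| vanish, so that the truncation loses nothing. *)
Definition int_part x : {poly F} := \poly_(j < `|ldeg x|.+1) x (- j%:Z).

Lemma coef_int_part x (j : nat) : (int_part x)`_j = x (- j%:Z).
Proof.
rewrite coef_poly; case: ifPn => // jx; have [->|x0] := eqVneq x 0; first by [].
by have [_ ->//] := ldegP x0; lia.
Qed.

Definition laurent_of_poly_coef (p : {poly F}) (n : int) : F :=
  if n <= 0 then p`_`|n|%N else 0.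

Lemma laurent_of_poly_subproof (p : {poly F}) :
  exists n0 : int, forall n, n < n0 -> laurent_of_poly_coef p n = 0.
Proof.
exists (- (size p)%:Z) => n np; rewrite /laurent_of_poly_coef.
have sp : (size p <= `|n|)%N by lia.
by case: ifP => // _; rewrite nth_default.
Qed.
Definition laurent_of_poly p := Laurent (laurent_of_poly_subproof p).

Lemma laurent_of_poly_is_additive : zmod_morphism laurent_of_poly.
Proof.
move=> p r; apply: laurent_ext => n /=; rewrite /laurent_of_poly_coef.
by case: ifP => // _; rewrite ?coefB ?subr0.
Qed.

Lemma laurent_of_poly_is_multiplicative : monoid_morphism laurent_of_poly.
Proof.
split.
  apply: laurent_ext => n /=; rewrite /laurent_of_poly_coef coef1.
  by case: ifPn => n0; rewrite ?absz_eq0// gt_eqF// ltNge.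
move=> p r; apply: laurent_ext => n.
have [n0|n0] := leP n 0; last first.
  rewrite /= {1}/laurent_of_poly_coef ifF; last by lia.
  rewrite /lmul_coef fsbig1// => i _ /=; rewrite /laurent_of_poly_coef.
  case: ifPn => i0; last by rewrite mul0r.
  by rewrite ifF ?mulr0//; lia.
rewrite /= /laurent_of_poly_coef n0 coefM.
pose k := `|n|%N; rewrite -/k /lmul_coef.
pose s := [seq - j%:Z | j <- iota 0 k.+1].
rewrite -(fsbig_widen [set` s] [set: int])//.
  rewrite -fsbig_seq /s; last by rewrite map_inj_uniq ?iota_uniq// => i j; lia.
  rewrite big_map -[k.+1]subn0 -/(index_iota 0 k.+1) big_mkord.
  apply: eq_bigr => -[j /= jk] _; rewrite /laurent_of_poly_coef.
  by rewrite !ifT; [|lia|lia]; congr (p`_ _ * r`_ _); lia.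
move=> i [_ /negP ir]; rewrite /= /laurent_of_poly_coef.
case: ifPn => i0; last by rewrite mul0r.
rewrite ifF ?mulr0//; apply/negbTE; apply: contra ir => ni.
by apply/mapP; exists `|i|%N; [rewrite mem_iota; lia|lia].
Qed.

HB.instance Definition _ := GRing.isZmodMorphism.Build _ _ laurent_of_poly
  laurent_of_poly_is_additive.
HB.instance Definition _ := GRing.isMonoidMorphism.Build _ _ laurent_of_poly
  laurent_of_poly_is_multiplicative.

(* membership in F(X), embedded by expansion at infinity *)
Definition is_rational x := exists p r : {poly F},
  r != 0 /\ x = laurent_of_poly p / laurent_of_poly r.

End LaurentField.

Section Norm.
Context (R : realType) {F : finFieldType}.
Implicit Types x y : laurent F.

Definition lnorm x : R := if x == 0 then 0 else (#|F|%:R : R) ^ (ldeg x).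

Lemma card_gt1 : 1 < #|F|%:R :> R.
Proof. by rewrite ltr1n card_finNzRing_gt1. Qed.

Lemma lnorm_ge0 x : 0 <= lnorm x.
Proof. by rewrite /lnorm; case: ifP => // _; rewrite exprz_ge0. Qed.

Lemma lnorm0 : lnorm 0 = 0.
Proof. by rewrite /lnorm eqxx. Qed.

Lemma lnorm_eq0 x : lnorm x = 0 -> x = 0.
Proof.
rewrite /lnorm; case: eqVneq => // _ /eqP; rewrite gt_eqF// exprz_gt0//.
exact: lt_trans card_gt1.
Qed.

Lemma lnorm_le x (k : int) :
  (forall n, n < - k -> x n = 0) -> lnorm x <= (#|F|%:R : R) ^ k.
Proof.
move=> h; rewrite /lnorm; case: eqVneq => [_|x0]; first by rewrite exprz_ge0.
rewrite ler_eXz2l ?card_gt1// leNgt; apply/negP => kx.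
by have [/eqP + _] := ldegP x0; apply; apply: h; lia.
Qed.

Lemma lnormN x : lnorm (- x) = lnorm x.
Proof.
rewrite /lnorm oppr_eq0; case: ifP => // _; congr (_ ^ _).
rewrite /ldeg; congr (- xget _ _); apply/predeqP => v; rewrite /is_lorder /=.
by rewrite oppr_eq0; split=> -[xv h]; split=> // m /h/eqP;
   rewrite ?oppr_eq0 => /eqP // ->; rewrite oppr0.
Qed.

Lemma lnormD x y : lnorm (x + y) <= lnorm x + lnorm y.
Proof.
wlog xy : x y / lnorm x <= lnorm y.
  move=> W; have [/W//|/ltW/W] := leP (lnorm x) (lnorm y).
  by rewrite addrC [leRHS]addrC.
apply: (@le_trans _ _ (lnorm y)); last by rewrite lerDr lnorm_ge0.
have [x0|x0] := eqVneq x 0; first by rewrite x0 add0r.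
have [y0|y0] := eqVneq y 0.
  by move: xy; rewrite y0 addr0.
have [_ hx] := ldegP x0; have [_ hy] := ldegP y0.
move: xy; rewrite /lnorm (negbTE x0) (negbTE y0) ler_eXz2l ?card_gt1// => xy.
apply: lnorm_le => n ny; rewrite [LHS]/= hx ?hy ?addr0//; lia.
Qed.

Lemma lnorm_frac_part x : lnorm (x - laurent_of_poly (int_part x)) < 1.
Proof.
apply: (@le_lt_trans _ _ ((#|F|%:R : R) ^ (- 1))).
  apply: lnorm_le => n n1; rewrite [LHS]/= /laurent_of_poly_coef ifT; last by lia.
  by rewrite coef_int_part (_ : - _ = n) ?subrr//; lia.
by rewrite exprN1 invf_lt1 ?card_gt1// (lt_trans _ card_gt1).
Qed.

End Norm.

Definition Delta (R : realType) (F : finFieldType) : Type :=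
  {x : laurent F | lnorm R x < 1}.

HB.instance Definition _ (R : realType) (F : finFieldType) :=
  SubChoice.on (Delta R F).

Section DeltaMetric.
Context {R : realType} {F : finFieldType}.
Implicit Types x y : Delta R F.

Definition ddist x y : R := lnorm R (val x - val y).

Lemma ddistxx x : ddist x x = 0.
Proof. by rewrite /ddist subrr lnorm0. Qed.

Lemma ddist_positivity x y : ddist x y = 0 -> x = y.
Proof. by move=> /lnorm_eq0/eqP; rewrite subr_eq0 => /eqP/val_inj. Qed.

Lemma ddist_sym x y : ddist x y = ddist y x.
Proof. by rewrite /ddist -lnormN opprB. Qed.

Lemma ddist_triangle y x z : ddist x z <= ddist x y + ddist y z.
Proof.
rewrite /ddist (_ : val x - val z = (val x - val y) + (val y - val z)).
  exact: lnormD.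
by rewrite addrA subrK.
Qed.

HB.instance Definition _ := isMetric.Build R (Delta R F)
  ddistxx ddist_positivity ddist_sym ddist_triangle.

End DeltaMetric.

Section ContinuedFractions.
Context {R : realType} {F : finFieldType}.
Implicit Types x : Delta R F.

Definition gauss_val x : laurent F :=
  if val x == 0 then 0
  else (val x)^-1 - laurent_of_poly (int_part (val x)^-1).

Lemma gauss_subproof x : lnorm R (gauss_val x) < 1.
Proof.
rewrite /gauss_val; case: ifP => _; first by rewrite lnorm0.
exact: lnorm_frac_part.
Qed.

Definition gauss x : Delta R F := Sub (gauss_val x) (gauss_subproof x).

(* A_n(x) for n >= 1; junk when T^(n-1) x = 0, and at n = 0 *)
Definition digit (n : nat) x : {poly F} :=
  int_part (val (iter n.-1 gauss x))^-1.

End ContinuedFractions.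

Definition distinct_digits (R : realType) (F : finFieldType)
    : set (Delta R F) :=
  [set x | ~ is_rational (val x) /\
    forall m n : nat, (1 <= m)%N -> (1 <= n)%N -> m <> n ->
      digit m x <> digit n x].

Definition pdeg (F : fieldType) (A : {poly F}) : nat := (size A).-1.

Definition nonconst_poly (F : fieldType) : set {poly F} :=
  [set A | (1 <= pdeg A)%N].

Definition Q_ (F : fieldType) (N : nat) (S : set {poly F}) : set {poly F} :=
  [set A | S A /\ (pdeg A <= N)%N].

(* [fset_set B] is empty when B is infinite; it is only used here on finite
   sets.  The quotients 0 / 0 at N = 0 do not affect the limsup. *)
Definition upper_density_poly (R : realType) (F : finFieldType)
    (S : set {poly F}) : \bar R :=
  limn_esup (fun N : nat =>
    (#|` fset_set (Q_ N S)|%:R / #|` fset_set (Q_ N (@nonconst_poly F))|%:R)%:E).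

Definition upper_density_nat (R : realType) (B : set nat) : \bar R :=
  limn_esup (fun N : nat =>
    (#|` fset_set (B `&` [set k | (1 <= k <= N)%N])|%:R / N%:R)%:E).

Section Hausdorff.
Context {R : realType} {T : metricType R}.
Implicit Types (A : set T) (s delta : R).
Local Open Scope ereal_scope.

(* [0] is adjoined so that the empty set has diameter 0. *)
Definition diam A : \bar R :=
  ereal_sup ([set 0] `|` [set (mdist x y)%:E | x in A & y in A]).

Definition is_cover delta A (U : nat -> set T) :=
  A `<=` \bigcup_i U i /\ forall i, diam (U i) <= delta%:E.

(* Finite covers are padded with empty sets, which contribute nothing, even
   for s = 0. *)
Definition hausdorff_content s delta A : \bar R :=
  ereal_inf [set \sum_(0 <= i <oo | U i != set0) (diam (U i) `^ s)
            | U in is_cover delta A].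

(* The content is nonincreasing in delta, so the sup is the limit at 0. *)
Definition hausdorff_measure s A : \bar R :=
  ereal_sup [set hausdorff_content s delta A | delta in [set d | (0 < d)%R]].

Definition hausdorff_dim A : \bar R :=
  ereal_inf [set s%:E | s in [set s | (0 <= s)%R /\ hausdorff_measure s A = 0]].

End Hausdorff.

(* Main.v *)
(** Upper bound.  A word of n distinct digits contains at most q^M digits of
    degree < M.  For u = q^(-2s) with s > 1/2 and u < u' < 1/q, every other digit
    gains a factor (u/u')^M when the weight u^deg is replaced by u'^deg, whose sum
    over all polynomials converges.  So the s-dimensional cost of the cover by
    cylinders of order n tends to 0.

    Lower bound.  The digit at a generic position n ranges freely over the
    q^(n(n+1)) polynomials of degree (n+1)^2 that agree with a fixed one in all
    degrees >= n(n+1); the elements of S outside these families are inserted, one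
    each, at very sparse positions.  The families have density 0 and avoid a
    chosen element of S of each degree, so both densities of S are carried by
    the inserted digits.  The logarithm of the number of words of length n is
    asymptotic to the total degree of n+1 digits, and digit sequences that differ
    within the first n digits are at distance at least q^(-2 * total degree),
    which gives dimension 1/2.  In place of a mass distribution, a countable
    cover of total mass < 1 is avoided by a branch of the tree of words chosen
    greedily. *)
Require Import Defs.
From HB Require Import structures.
From mathcomp Require Import all_boot all_order all_algebra.
From mathcomp Require Import finmap zify ring lra.
From mathcomp Require Import all_classical all_reals all_analysis.

Set Implicit Arguments.
Unset Strict Implicit.
Unset Printing Implicit Defensive.

Import Order.TTheory GRing.Theory Num.Theory.
Import numFieldNormedType.Exports.

Local Open Scope classical_set_scope.
Local Open Scope ring_scope.

(** * Orders and degrees of Laurent series *)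

Section LaurentOrder.
Context {F : fieldType}.
Implicit Types x y : laurent F.

Lemma is_lorder_uniq x v w : is_lorder x v -> is_lorder x w -> v = w.
Proof.
move=> [xv hv] [xw hw]; have [vw|wv|//] := ltgtP v w.
  by move: xv; rewrite (hw _ vw) eqxx.
by move: xw; rewrite (hv _ wv) eqxx.
Qed.

Lemma is_lorder_neq0 x v : is_lorder x v -> x != 0.
Proof. by case=> xv _; apply: contra_neq xv => ->. Qed.

Lemma is_lorder_ldeg x v : is_lorder x v -> ldeg x = - v.
Proof.
move=> xv; have /ldegP h := is_lorder_neq0 xv.
by rewrite (is_lorder_uniq xv h) opprK.
Qed.

Lemma is_lorderM x y v w :
  is_lorder x v -> is_lorder y w -> is_lorder (x * y) (v + w).
Proof.
move=> [xv hv] [yw hw]; split; last by move=> m; exact: lmul_coef0.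
have -> : (x * y) (v + w) = x v * y w.
  rewrite [LHS](lmul_coefE (N := 1) hv hw).
    by rewrite big_ord1 addr0 [v + w]addrC addrK.
  by rewrite [v + w]addrC addrK subrr.
by rewrite mulf_neq0.
Qed.

Lemma ldegM x y : x != 0 -> y != 0 -> ldeg (x * y) = ldeg x + ldeg y.
Proof.
move=> /ldegP hx /ldegP hy.
by rewrite (is_lorder_ldeg (is_lorderM hx hy)) opprD !opprK.
Qed.

Lemma laurent_of_poly_order (p : {poly F}) :
  p != 0 -> is_lorder (laurent_of_poly p) (- (pdeg p)%:Z).
Proof.
move=> p0; split.
  rewrite /= /laurent_of_poly_coef ifT; last by lia.
  by rewrite abszN absz_nat -lead_coefE lead_coef_eq0.
move=> m hm; rewrite /= /laurent_of_poly_coef; case: ifP => // _.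
rewrite nth_default//; move: hm; rewrite /pdeg; case: (size p) => [|k] /= hm.
  lia.
lia.
Qed.

Lemma laurent_of_poly_eq0 (p : {poly F}) : (laurent_of_poly p == 0) = (p == 0).
Proof.
have [->|p0] := eqVneq p 0; first by rewrite raddf0 eqxx.
exact/negbTE/is_lorder_neq0/laurent_of_poly_order.
Qed.

End LaurentOrder.

(** * The absolute value of a Laurent series *)

Section NormTheory.
Context (R : realType) {F : finFieldType}.
Implicit Types x y : laurent F.
Local Notation q := (#|F|%:R : R).
Local Notation N := (@lnorm R F).

Lemma q_gt0 : 0 < q. Proof. exact: lt_trans ltr01 (card_gt1 R). Qed.

Lemma lnorm_neq0 x : x != 0 -> N x = q ^ ldeg x.
Proof. by rewrite /lnorm => /negbTE ->. Qed.

Lemma lnorm_gt0 x : x != 0 -> 0 < N x.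
Proof. by move=> x0; rewrite lnorm_neq0// exprz_gt0// q_gt0. Qed.

Lemma lnormM x y : N (x * y) = N x * N y.
Proof.
have [->|x0] := eqVneq x 0; first by rewrite mul0r lnorm0 mul0r.
have [->|y0] := eqVneq y 0; first by rewrite mulr0 lnorm0 mulr0.
rewrite !lnorm_neq0 ?mulf_neq0// ldegM// expfzDr//; exact/lt0r_neq0/q_gt0.
Qed.

Lemma lnorm1 : N 1 = 1.
Proof.
have h := lnormM 1 1; move: h; rewrite mulr1 => /esym h.
have n0 : N 1 != 0 by rewrite gt_eqF// lnorm_gt0// oner_neq0.
by apply: (mulfI n0); rewrite mulr1.
Qed.

Lemma lnormV x : N x^-1 = (N x)^-1.
Proof.
have [->|x0] := eqVneq x 0; first by rewrite invr0 lnorm0 invr0.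
have n0 : N x != 0 by rewrite gt_eqF// lnorm_gt0.
by apply: (mulfI n0); rewrite -lnormM !divff// lnorm1.
Qed.

Lemma lnorm_leP x (k : int) :
  N x <= q ^ k <-> forall n, n < - k -> x n = 0.
Proof.
split; last exact: lnorm_le.
move=> h n nk; have [->|x0] := eqVneq x 0; first by [].
move: h; rewrite lnorm_neq0// ler_eXz2l ?card_gt1// => h.
have [_ hx] := ldegP x0; apply: hx; lia.
Qed.

(** The nonzero values of the norm are integer powers of [q], so [< q ^ k] amounts to
    [<= q ^ (k - 1)]. *)
Lemma lnorm_ltP x (k : int) :
  N x < q ^ k <-> forall n, n <= - k -> x n = 0.
Proof.
have -> : (N x < q ^ k) = (N x <= q ^ (k - 1)).
  have [->|x0] := eqVneq x 0.
    by rewrite lnorm0 exprz_gt0 ?q_gt0// exprz_ge0// ltW// q_gt0.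
  rewrite lnorm_neq0// ltr_eXz2l ?ler_eXz2l ?card_gt1//; lia.
by split=> [/lnorm_leP h n nk|h]; [apply: h|apply/lnorm_leP => n nk; apply: h]; lia.
Qed.

Lemma lnorm_lt1P x : N x < 1 <-> forall n, n <= 0 -> x n = 0.
Proof. by rewrite -(expr0z q) lnorm_ltP oppr0. Qed.

Lemma lnormD_lt1 x y : N x < 1 -> N y < 1 -> N (x + y) < 1.
Proof.
move=> /lnorm_lt1P hx /lnorm_lt1P hy; apply/lnorm_lt1P => n n0.
by rewrite [LHS]/= hx// hy// addr0.
Qed.

Lemma lnorm_poly (p : {poly F}) :
  p != 0 -> N (laurent_of_poly p) = q ^+ pdeg p.
Proof.
move=> p0; rewrite lnorm_neq0 ?laurent_of_poly_eq0//.
by rewrite (is_lorder_ldeg (laurent_of_poly_order p0)) opprK.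
Qed.

End NormTheory.

(** * Continued fractions: distances, irrationality, prescribed digits *)

Section ContinuedFractionTheory.
Context (R : realType) {F : finFieldType}.
Local Notation q := (#|F|%:R : R).
Local Notation N := (@lnorm R F).
Implicit Types x y : Delta R F.

Lemma pdeg_gt0_neq0 (p : {poly F}) : (1 <= pdeg p)%N -> p != 0.
Proof. by apply: contraTneq => ->; rewrite /pdeg size_poly0. Qed.

Lemma lnormD_le (u v : laurent F) (k : int) :
  N u <= q ^ k -> N v <= q ^ k -> N (u + v) <= q ^ k.
Proof.
move=> /lnorm_leP hu /lnorm_leP hv; apply/lnorm_leP => n nk.
by rewrite [LHS]/= hu// hv// addr0.
Qed.

Lemma pdeg_int_part (u : laurent F) (d : nat) :
  is_lorder u (- d%:Z) -> pdeg (int_part u) = d.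
Proof.
move=> ud; have dE := is_lorder_ldeg ud; rewrite opprK in dE.
have s1 : (size (int_part u) <= d.+1)%N.
  by apply: leq_trans (size_poly _ _) _; rewrite dE.
have s2 : (d < size (int_part u))%N.
  rewrite ltnNge; apply/negP => /(nth_default 0).
  by rewrite coef_int_part; case: ud => /eqP.
by rewrite /pdeg; lia.
Qed.

Lemma int_part_poly_frac (p : {poly F}) (u : laurent F) :
  N u < 1 -> int_part (laurent_of_poly p + u) = p.
Proof.
move=> /lnorm_lt1P hu; apply/polyP => i; rewrite coef_int_part [LHS]/=.
rewrite hu ?addr0 /laurent_of_poly_coef; last by lia.
by rewrite ifT; [rewrite abszN absz_nat|lia].
Qed.

Lemma lnorm_Delta x : N (val x) < 1.
Proof. exact: (valP x). Qed.

Lemma lorder_inv x : val x != 0 ->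
  exists2 d : nat, (1 <= d)%N & is_lorder (val x)^-1 (- d%:Z) /\ N (val x) = q ^- d.
Proof.
move=> x0; have xV0 : (val x)^-1 != 0 by rewrite invr_eq0.
have /ldegP h := xV0.
have NE := lnorm_neq0 R xV0.
have : 1 < N (val x)^-1 by rewrite lnormV invf_gt1 ?lnorm_gt0 ?(valP x).
rewrite NE -[ltLHS](expr0z q) ltr_eXz2l ?card_gt1// => d0.
have dE : ldeg (val x)^-1 = `|ldeg (val x)^-1|%N%:Z by lia.
set e := ldeg _ in NE dE d0 h; exists `|e|%N; first by lia.
rewrite -dE; split=> //; rewrite -[LHS]invrK -lnormV NE; congr (_^-1).
by rewrite {1}dE.
Qed.

Lemma digit1_gt0 x : val x != 0 -> (1 <= pdeg (digit 1 x))%N.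
Proof. by move=> /lorder_inv[d d1 [h _]]; rewrite /digit (pdeg_int_part h). Qed.

Lemma lnorm_digit1 x : val x != 0 -> N (val x) = q ^- pdeg (digit 1 x).
Proof.
by move=> /lorder_inv[d d1 [h ->]]; rewrite /digit (pdeg_int_part h).
Qed.

Lemma inv_digit1 x : val x != 0 ->
  (val x)^-1 = laurent_of_poly (digit 1 x) + val (gauss x).
Proof. by move=> x0; rewrite /= /gauss_val (negbTE x0) addrC subrK. Qed.

Lemma digitS n x : digit n.+2 x = digit n.+1 (gauss x).
Proof. by rewrite /digit /= -iterSr. Qed.

(** This is |x - y| = |x| |y| |1/x - 1/y|, with both inverses split into integral part and Gauss
    image. *)
Lemma ddist_gauss x y : val x != 0 -> val y != 0 ->
  ddist x y = N (val x) * N (val y) *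
    N (laurent_of_poly (digit 1 x - digit 1 y) + (val (gauss x) - val (gauss y))).
Proof.
move=> x0 y0.
have -> : laurent_of_poly (digit 1 x - digit 1 y) + (val (gauss x) - val (gauss y))
  = (val x)^-1 - (val y)^-1.
  by rewrite (inv_digit1 x0) (inv_digit1 y0) rmorphB /=; ring.
rewrite -!lnormM -lnormN; congr (N _).
by field; rewrite x0 y0.
Qed.

Lemma ddist_same_digit x y : val x != 0 -> val y != 0 ->
  digit 1 x = digit 1 y ->
  ddist x y = q ^- (2 * pdeg (digit 1 x)) * ddist (gauss x) (gauss y).
Proof.
move=> x0 y0 xy; rewrite ddist_gauss// xy subrr raddf0 add0r; congr (_ * _).
by rewrite !lnorm_digit1// xy mul2n -addnn exprD invfM.
Qed.

(** A sum of norm below 1 has integral part 0, whereas the integral part of this one is [p]. *)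
Lemma lnorm_poly_frac_ge1 (p : {poly F}) (u : laurent F) :
  N u < 1 -> p != 0 -> 1 <= N (laurent_of_poly p + u).
Proof.
move=> u1; apply: contra_neqT; rewrite -ltNge => h.
by rewrite -(int_part_poly_frac p u1) -[laurent_of_poly p + u]add0r -(raddf0 laurent_of_poly) int_part_poly_frac.
Qed.

Lemma ddist_diff_digit x y : val x != 0 -> val y != 0 ->
  digit 1 x != digit 1 y ->
  q ^- (pdeg (digit 1 x) + pdeg (digit 1 y)) <= ddist x y.
Proof.
move=> x0 y0 xy; rewrite ddist_gauss// !lnorm_digit1// exprD invfM.
rewrite ler_peMr// ?mulr_ge0 ?invr_ge0 ?exprn_ge0//.
apply: lnorm_poly_frac_ge1; last by rewrite subr_eq0.
by apply: lnormD_lt1; rewrite ?lnormN; exact: lnorm_Delta.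
Qed.

Lemma ddist_lt1 x y : ddist x y < 1.
Proof. by apply: lnormD_lt1; rewrite ?lnormN; exact: lnorm_Delta. Qed.

Lemma ddist_cylinder n x y :
  (forall k, val (iter k gauss x) != 0) -> (forall k, val (iter k gauss y) != 0) ->
  (forall k, (k < n)%N -> digit k.+1 x = digit k.+1 y) ->
  ddist x y <= q ^- (2 * \sum_(k < n) pdeg (digit k.+1 x)).
Proof.
elim: n x y => [|n IHn] x y x0 y0 xy.
  by rewrite big_ord0 muln0 expr0 invr1 ltW// ddist_lt1.
rewrite (ddist_same_digit (x0 0%N) (y0 0%N) (xy 0%N isT)) big_ord_recl mulnDr.
rewrite exprD invfM ler_wpM2l ?invr_ge0 ?exprn_ge0//.
rewrite (eq_bigr (fun k : 'I_n => pdeg (digit k.+1 (gauss x)))); last first.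
  by move=> k _; rewrite -digitS.
apply: IHn => k; rewrite -?iterSr// => kn.
by rewrite -!digitS; apply: xy.
Qed.

(** Since the degrees agree, distinct first digits of degree d force distance at least q^(-2d);
    common ones rescale the distance by exactly q^(-2d), and the induction passes to the Gauss
    images. *)
Lemma digit_separation n x y :
  (forall k, val (iter k gauss x) != 0) -> (forall k, val (iter k gauss y) != 0) ->
  (forall k, (k < n)%N -> pdeg (digit k.+1 x) = pdeg (digit k.+1 y)) ->
  ddist x y < q ^- (2 * \sum_(k < n) pdeg (digit k.+1 x)) ->
  forall k, (k < n)%N -> digit k.+1 x = digit k.+1 y.
Proof.
elim: n x y => [//|n IHn] x y x0 y0 dxy.
rewrite big_ord_recl mulnDr => h.
have q0 := q_gt0 R (F := F).
have xy : digit 1 x = digit 1 y.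
  apply/eqP/negP => /negP xy; move: h; apply/negP; rewrite -leNgt.
  apply: le_trans (ddist_diff_digit (x0 0%N) (y0 0%N) xy).
  rewrite -(dxy 0%N isT) addnn -mul2n exprD invfM ler_piMr ?invr_ge0 ?exprn_ge0//.
  by rewrite invf_le1 ?exprn_gt0// exprn_ege1// ltW ?card_gt1.
move: h; rewrite (ddist_same_digit (x0 0%N) (y0 0%N) xy) exprD invfM.
rewrite ltr_pM2l ?invr_gt0 ?exprn_gt0// => h.
case=> [//|k] kn; rewrite !digitS; apply: IHn => //.
- by move=> j; rewrite -iterSr.
- by move=> j; rewrite -iterSr.
- by move=> j jn; rewrite -!digitS; apply: dxy.
- apply: lt_le_trans h _; rewrite (eq_bigr (fun k : 'I_n => pdeg (digit k.+1 (gauss x))))//.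
  by move=> j _; rewrite -digitS.
Qed.

Lemma is_rational0 : is_rational (0 : laurent F).
Proof. by exists 0, 1; rewrite oner_neq0 raddf0 mul0r. Qed.

(** Rationality pulls back along the Gauss map, because 1/y is the sum of a polynomial and the Gauss
    image of y; and 0 is rational. *)
Lemma irrational_iter_neq0 x : ~ is_rational (val x) ->
  forall n, val (iter n gauss x) != 0.
Proof.
move=> xi n; suff : ~ is_rational (val (iter n gauss x)).
  by apply: contra_notN => /eqP ->; exact: is_rational0.
elim: n => // n; apply: contra_not; rewrite iterS; set y := iter n gauss x.
have [-> _|y0] := eqVneq (val y) 0; first exact: is_rational0.
move=> [p [r [r0 yE]]].
have r0' : laurent_of_poly r != 0 by rewrite laurent_of_poly_eq0.
have E : (val y)^-1 = laurent_of_poly (digit 1 y * r + p) / laurent_of_poly r.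
  by rewrite (inv_digit1 y0) yE rmorphD rmorphM /=; field.
exists r, (digit 1 y * r + p); split.
  by apply: contraTneq y0 => h; rewrite -[val y]invrK E h raddf0 mul0r invr0 eqxx.
by rewrite -[val y]invrK E invf_div.
Qed.

(* A fraction p / r in Delta has deg p < deg r, and the Gauss map turns it into
   a fraction with denominator p: the denominators decrease as in Euclid's
   algorithm. *)
Lemma iter_neq0_irrational x : (forall n, val (iter n gauss x) != 0) ->
  ~ is_rational (val x).
Proof.
move=> x0 [p [r [r0 xE]]]; have [n rn] := ubnP (size r).
elim: n => // n IHn in x p r r0 x0 xE rn *.
have p0 : p != 0.
  by apply: contraNneq (x0 0%N) => p0; rewrite /= xE p0 raddf0 mul0r.
have r0' : laurent_of_poly r != 0 by rewrite laurent_of_poly_eq0.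
have p0' : laurent_of_poly p != 0 by rewrite laurent_of_poly_eq0.
have pr : (size p < size r)%N.
  have := valP x; rewrite xE lnormM lnormV !lnorm_poly//.
  rewrite ltr_pdivrMr ?exprn_gt0 ?q_gt0// mul1r ltr_eXn2l ?card_gt1//.
  by move: p0 r0; rewrite /pdeg -!size_poly_gt0; lia.
apply: (IHn (gauss x) (r - digit 1 x * p) p p0); last by lia.
  by move=> k; rewrite -iterSr.
have := inv_digit1 (x0 0%N); rewrite xE invf_div => /(canLR (addKr _)) <-.
by rewrite rmorphB rmorphM /= -/(digit 1 x); field.
Qed.

(** The recursion peels off the outermost digit, so that shifting [a] matches one step of the Gauss
    map; the tail after [n] digits is replaced by 0. *)
Fixpoint convergent (n : nat) (a : nat -> {poly F}) : laurent F :=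
  if n is m.+1 then (laurent_of_poly (a 0%N) + convergent m (fun k => a k.+1))^-1
  else 0.

(** The leading term of [p] survives, since [u] has only negative powers of X. *)
Lemma lnorm_poly_frac (p : {poly F}) (u : laurent F) :
  (1 <= pdeg p)%N -> N u < 1 -> q <= N (laurent_of_poly p + u).
Proof.
move=> p1 u1; rewrite leNgt -[ltRHS](expr1z q); apply/negP => /lnorm_ltP h.
have p0 := pdeg_gt0_neq0 p1.
move: u1 => /lnorm_lt1P/(_ (- (pdeg p)%:Z)) u0.
have [/eqP + _] := laurent_of_poly_order p0; apply.
have p1' : (1 <= pdeg p)%N by [].
have le1 : - (pdeg p)%:Z <= -1 by lia.
have := h _ le1; rewrite /= u0 ?addr0//; lia.
Qed.

Lemma convergent_lt1 n a : (forall n, (1 <= pdeg (a n))%N) ->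
  N (convergent n a) < 1.
Proof.
elim: n a => [|n IHn] a a1 /=; first by rewrite lnorm0.
have h := lnorm_poly_frac (a1 0%N) (IHn (fun k => a k.+1) (fun k => a1 k.+1)).
have h1 := lt_le_trans (card_gt1 R) h.
by rewrite lnormV invf_lt1// (lt_trans _ h1).
Qed.

(** Inverting divides a difference by two quantities of norm at least [q]; a single factor [q] per
    level suffices here. *)
Lemma convergent_step n a : (forall n, (1 <= pdeg (a n))%N) ->
  N (convergent n.+1 a - convergent n a) <= q ^ (- n%:Z).
Proof.
elim: n a => [|n IHn] a a1.
  by rewrite subr0 expr0z ltW// convergent_lt1.
have hS k : (1 <= pdeg (a k.+1))%N by [].
have hu := lnorm_poly_frac (a1 0%N) (convergent_lt1 n.+1 hS).
have hv := lnorm_poly_frac (a1 0%N) (convergent_lt1 n hS).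
have {IHn} := IHn _ hS; move: hu hv.
rewrite [convergent n.+2 a]/= [convergent n.+1 a]/=.
rewrite -[(laurent_of_poly (a 1%N) + _)^-1]/(convergent n.+1 (fun k => a k.+1)).
set u := convergent n.+1 _; set v := convergent n _; set p := laurent_of_poly _.
have q0 := q_gt0 R (F := F).
move=> hu hv uv.
have u0 : p + u != 0.
  by apply: contraTneq hu => ->; rewrite lnorm0 -ltNge.
have v0 : p + v != 0.
  by apply: contraTneq hv => ->; rewrite lnorm0 -ltNge.
have -> : (p + u)^-1 - (p + v)^-1 = (v - u) / ((p + u) * (p + v)).
  by field; rewrite u0 v0.
rewrite lnormM lnormV lnormM -lnormN opprB ler_pdivrMr; last first.
  by rewrite mulr_gt0// (lt_le_trans q0).
have -> : - n.+1%:Z = - n%:Z - 1 by lia.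
rewrite expfzDr; last exact: lt0r_neq0.
rewrite exprN1 -mulrA; apply: le_trans uv _.
rewrite ler_peMr ?exprz_ge0 ?(ltW q0)// ler_pdivlMl// mulr1.
by rewrite (le_trans hu)// ler_peMr ?lnorm_ge0// (le_trans _ hv)// ltW ?card_gt1.
Qed.

Lemma convergent_stable n m a i : (forall n, (1 <= pdeg (a n))%N) ->
  i < n%:Z -> (n <= m)%N -> convergent m a i = convergent n a i.
Proof.
move=> a1 hi /subnK <-; elim: (m - n)%N => [//|k IHk]; rewrite addSn -IHk.
have /lnorm_leP h := convergent_step (k + n) a1.
by apply/eqP; rewrite -subr_eq0; apply/eqP/(h i); lia.
Qed.

Lemma cf_subproof a : exists n0 : int, forall n, n < n0 ->
  (if n <= 0 then 0 else convergent `|n|.+1 a n) = 0.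
Proof. by exists 0 => n /ltW ->. Qed.

(** The coefficient of X^-n is read off the convergent of order n + 1, from which on it is stable
    when the digits are nonconstant. Setting it to 0 for n <= 0 puts the series in [Delta] for every
    [a]. *)
Definition cf_val a : laurent F := Laurent (cf_subproof a).

Lemma cf_val_lt1 a : N (cf_val a) < 1.
Proof. by apply/lnorm_lt1P => n /= ->. Qed.

Definition cf a : Delta R F := Sub (cf_val a) (cf_val_lt1 a).

Lemma cf_val_convergent n a : (forall n, (1 <= pdeg (a n))%N) ->
  N (cf_val a - convergent n a) <= q ^ (- n%:Z).
Proof.
move=> a1; apply/lnorm_leP => i; rewrite opprK => hi.
rewrite [LHS]/=; apply/eqP; rewrite subr_eq0; apply/eqP; case: ifP => i0.
  by have /lnorm_lt1P -> := convergent_lt1 n a1.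
rewrite -(@convergent_stable `|i|.+1 (maxn `|i|.+1 n) a)//; last 2 first.
- by lia.
- by rewrite leq_maxl.
by rewrite (@convergent_stable n)// leq_maxr.
Qed.

(** The convergents satisfy this identity exactly, so its defect for the limit is smaller than every
    power of [q]. *)
Lemma cf_valE a : (forall n, (1 <= pdeg (a n))%N) ->
  (cf_val a)^-1 = laurent_of_poly (a 0%N) + cf_val (fun k => a k.+1).
Proof.
move=> a1; set a' := fun k => a k.+1; have a1' k : (1 <= pdeg (a' k))%N := a1 k.+1.
set p := laurent_of_poly _; have q0 := q_gt0 R (F := F).
have p0 := pdeg_gt0_neq0 (a1 0%N).
have hp : N (p + cf_val a') <= q ^ (pdeg (a 0%N))%:Z.
  apply: lnormD_le; first by rewrite lnorm_poly.
  apply: le_trans (ltW (cf_val_lt1 a')) _.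
  by rewrite -exprnP exprn_ege1// ltW// card_gt1.
suff E : cf_val a * (p + cf_val a') - 1 = 0.
  have E1 : cf_val a * (p + cf_val a') = 1 by apply/eqP; rewrite -subr_eq0 E.
  have x0 : cf_val a != 0.
    by apply: contra_eq_neq E1 => ->; rewrite mul0r eq_sym oner_neq0.
  by apply: (mulfI x0); rewrite E1 divff.
apply: laurent_ext => i.
suff : N (cf_val a * (p + cf_val a') - 1) <= q ^ (- (`|i|.+1)%:Z).
  by move/lnorm_leP => -> //; rewrite opprK; lia.
(* The summand [pdeg (a 0)] compensates the norm of [p + cf_val a'], which multiplies the first
   approximation error. *)
set n := (`|i|.+1 + pdeg (a 0%N))%N.
have v0 : p + convergent n a' != 0.
  have := lnorm_poly_frac (a1 0%N) (convergent_lt1 n a1').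
  by apply: contraTneq => h; rewrite -/p h lnorm0 -ltNge.
have -> : cf_val a * (p + cf_val a') - 1 =
    (cf_val a - convergent n.+1 a) * (p + cf_val a') +
    convergent n.+1 a * (cf_val a' - convergent n a').
  have -> : convergent n.+1 a = (p + convergent n a')^-1 by [].
  by field.
apply: lnormD_le; rewrite lnormM.
  apply: le_trans (ler_pM _ _ (cf_val_convergent n.+1 a1) hp) _; rewrite ?lnorm_ge0//.
  by rewrite -expfzDr ?lt0r_neq0// ler_eXz2l ?card_gt1//; lia.
apply: (@le_trans _ _ (N (cf_val a' - convergent n a'))).
  by rewrite ler_piMl ?lnorm_ge0// ltW// convergent_lt1.
apply: le_trans (cf_val_convergent n a1') _.
by rewrite ler_eXz2l ?card_gt1//; lia.
Qed.

(** By [cf_valE] the inverse is [a 0] plus a series of norm below 1, and such a decomposition is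
    unique. *)
Lemma cf_spec a : (forall n, (1 <= pdeg (a n))%N) ->
  [/\ val (cf a) != 0, digit 1 (cf a) = a 0%N &
      gauss (cf a) = cf (fun k => a k.+1)].
Proof.
move=> a1; have E := cf_valE a1.
have x0 : cf_val a != 0.
  rewrite -invr_eq0 E; have := lnorm_poly_frac (a1 0%N) (cf_val_lt1 (fun k => a k.+1)).
  by apply: contraTneq => ->; rewrite lnorm0 -ltNge q_gt0.
have D : digit 1 (cf a) = a 0%N.
  by rewrite /digit /= E int_part_poly_frac// cf_val_lt1.
split=> //; apply: val_inj; have := inv_digit1 (x0 : val (cf a) != 0).
by rewrite D [in LHS]/= E => /addrI <-.
Qed.

Lemma iter_gauss_cf n a : (forall n, (1 <= pdeg (a n))%N) ->
  iter n gauss (cf a) = cf (fun k => a (k + n)%N).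
Proof.
elim: n a => [|n IHn] a a1.
  by congr (cf _); apply/funext => k; rewrite addn0.
rewrite iterSr; have [_ _ ->] := cf_spec a1; rewrite IHn//.
by congr (cf _); apply/funext => k; rewrite -addSnnS.
Qed.

Lemma digit_cf n a : (forall n, (1 <= pdeg (a n))%N) -> digit n.+1 (cf a) = a n.
Proof.
move=> a1; rewrite -[LHS]/(digit 1 (iter n gauss (cf a))) iter_gauss_cf//.
by have [_ -> _] := cf_spec (fun k => a1 (k + n)%N).
Qed.

Lemma cf_irrational a : (forall n, (1 <= pdeg (a n))%N) ->
  ~ is_rational (val (cf a)).
Proof.
move=> a1; apply: iter_neq0_irrational => n; rewrite iter_gauss_cf//.
by have [] := cf_spec (fun k => a1 (k + n)%N).
Qed.

End ContinuedFractionTheory.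

(** * Counting polynomials and summing weights over words *)

Section PolyCount.
Context {F : finFieldType}.
Implicit Types X : seq {poly F}.

Definition polys (n : nat) : seq {poly F} := [seq rVpoly v | v <- enum 'rV[F]_n].

Lemma mem_polys n (A : {poly F}) : (A \in polys n) = (size A <= n)%N.
Proof.
apply/mapP/idP => [[v _ ->]|An]; first exact: size_poly.
by exists (poly_rV A); rewrite ?mem_enum// poly_rV_K.
Qed.

Lemma uniq_polys n : uniq (polys n).
Proof. by rewrite map_inj_uniq ?enum_uniq//; exact: (can_inj rVpolyK). Qed.

Lemma size_polys n : size (polys n) = (#|F| ^ n)%N.
Proof. by rewrite size_map -cardE card_mx mul1n. Qed.

Lemma count_size_le X n :
  uniq X -> (count (fun A : {poly F} => (size A <= n)%N) X <= #|F| ^ n)%N.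
Proof.
move=> uX; rewrite -size_filter -size_polys; apply: uniq_leq_size.
  exact: filter_uniq.
by move=> A; rewrite mem_filter mem_polys => /andP[].
Qed.

End PolyCount.

Section FiniteSums.
Context {R : realType}.

Lemma ler_sum_subseq (I : eqType) (s s' : seq I) (f : I -> R) :
  (forall i, 0 <= f i) -> uniq s -> uniq s' -> {subset s <= s'} ->
  \sum_(i <- s) f i <= \sum_(i <- s') f i.
Proof.
move=> f0 us us' ss'.
have pss' : perm_eq s [seq i <- s' | i \in s].
  apply: uniq_perm; rewrite ?filter_uniq// => i; rewrite mem_filter.
  by have [/ss' ->|] := boolP (i \in s).
rewrite (perm_big _ pss') big_filter big_mkcond /=; apply: ler_sum => i _.
by case: ifP.
Qed.

(** The words embed into the product of their first letters and their tails, over which the sum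
    factors. *)
Lemma sum_words_le (T : eqType) (f : T -> R) (c : R) :
  (forall A, 0 <= f A) ->
  (forall X : seq T, uniq X -> \sum_(A <- X) f A <= c) ->
  forall n (L : seq (seq T)), uniq L -> all (fun v => size v == n) L ->
  \sum_(v <- L) \prod_(A <- v) f A <= c ^+ n.
Proof.
move=> f0 fc; have c0 : 0 <= c by have := fc [::] isT; rewrite big_nil.
elim=> [|n IHn] L uL sL.
  apply: le_trans (@ler_sum_subseq _ L [:: [::]] _ _ uL _ _) _ => //.
  - by move=> v; apply: prodr_ge0.
  - by move=> v /(allP sL); rewrite size_eq0 inE.
  - by rewrite big_seq1 big_nil expr0.
pose X := undup (flatten L); pose L' := undup (map behead L).
have fg0 v : 0 <= \prod_(A <- v) f A by apply: prodr_ge0.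
apply: (@le_trans _ _ (\sum_(v <- [seq A :: w | A <- X, w <- L']) \prod_(A <- v) f A)).
  apply: ler_sum_subseq => //.
    apply: allpairs_uniq; rewrite ?undup_uniq// => -[a1 a2] [b1 b2] _ _ /= [-> ->] //.
  move=> v vL; have := allP sL _ vL; case: v vL => [//|A w] vL _.
  apply/allpairsP; exists (A, w) => /=; split=> //.
    by rewrite mem_undup; apply/flattenP; exists (A :: w); rewrite ?mem_head.
  by rewrite mem_undup; apply/mapP; exists (A :: w).
rewrite big_allpairs_dep /=.
under eq_bigr do under eq_bigr do rewrite big_cons.
under eq_bigr do rewrite -big_distrr /=.
rewrite -big_distrl /= exprS ler_pM ?sumr_ge0// ?fc ?undup_uniq//.
apply: IHn; rewrite ?undup_uniq//; apply/allP => w.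
by rewrite mem_undup => /mapP[v /(allP sL)/eqP vn ->]; rewrite size_behead vn.
Qed.

Lemma expr_small (r e : R) : 0 <= r -> r < 1 -> 0 < e -> exists n : nat, r ^+ n <= e.
Proof.
move=> r0 r1 e0; have : (fun n => r ^+ n) @ \oo --> (0 : R).
  by apply: cvg_expr; rewrite ger0_norm.
move/cvgr0Pnorm_le => /(_ e e0)[n _ /(_ n (leqnn n)) h].
by exists n; rewrite (le_trans _ h)// ler_norm.
Qed.

End FiniteSums.

Section PolyWeights.
Context {R : realType} {F : finFieldType}.
Local Notation q := (#|F|%:R : R).

(** At most q^d polynomials have size d, so a geometric series of ratio [q * u] dominates. For A
    nonzero the weight is u^(deg A). *)
Lemma sum_weight_le (u : R) (X : seq {poly F}) : 0 < u -> q * u < 1 -> uniq X ->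
  \sum_(A <- X) u^-1 * u ^+ size A <= u^-1 * (1 - q * u)^-1.
Proof.
move=> u0 qu uX; have q0 := q_gt0 R (F := F).
have r0 : 0 <= q * u by rewrite mulr_ge0 ?ltW.
pose L := (\max_(A <- X) size A).+1.
rewrite -big_distrr /= ler_pM2l ?invr_gt0//.
apply: (@le_trans _ _ (\sum_(d < L) (q * u) ^+ d)).
  have -> : \sum_(A <- X) u ^+ size A =
      \sum_(A <- X) \sum_(d < L) (if size A == d :> nat then u ^+ d else 0).
    apply: eq_big_seq => A AX.
    have AL : (size A < L)%N by rewrite ltnS; apply: leq_bigmax_seq.
    rewrite (bigD1 (Ordinal AL))//= eqxx big1 ?addr0// => d.
    by rewrite eq_sym -val_eqE /= => /negbTE ->.
  rewrite exchange_big /=; apply: ler_sum => d _.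
  rewrite -big_mkcond /= big_const_seq iter_addr addr0 exprMn -[leLHS]mulr_natl.
  rewrite ler_wpM2r ?exprn_ge0 ?(ltW u0)// -natrX ler_nat.
  apply: leq_trans (count_size_le d uX).
  by apply: sub_count => A /= /eqP ->.
rewrite -(ler_pM2l (_ : 0 < 1 - q * u)) ?subr_gt0// divff ?gt_eqF ?subr_gt0//.
have -> : (1 - q * u) * \sum_(d < L) (q * u) ^+ d = 1 - (q * u) ^+ L.
  by rewrite -[RHS]opprB subrX1 -[RHS]mulNr opprB.
by rewrite gerBl exprn_ge0.
Qed.

(* Words with distinct letters contain a bounded number of letters of small
   degree; each of the other letters gains the factor t when u is replaced by
   u'. *)
Lemma word_weight_le (u u' t : R) (M : nat) (v : seq {poly F}) :
  0 < u -> u <= u' -> 0 < t -> t <= 1 -> (u / u') ^+ M <= t -> uniq v ->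
  all (fun A => 1 <= pdeg A)%N v ->
  \prod_(A <- v) u ^+ pdeg A <=
    t ^+ (size v - #|F| ^ M) * \prod_(A <- v) (u'^-1 * u' ^+ size A).
Proof.
move=> u0 uu' t0 t1 hM uv v1; have u'0 := lt_le_trans u0 uu'.
have [k kv] : exists k, k = count (fun A : {poly F} => (M < size A)%N) v by eexists.
have kM : (size v - #|F| ^ M <= k)%N.
  have := count_size_le M uv; rewrite -(count_predC (fun A : {poly F} => (size A <= M)%N) v) kv.
  rewrite (eq_count (a1 := predC _) (a2 := fun A : {poly F} => (M < size A)%N)); first by lia.
  by move=> A /=; rewrite -ltnNge.
apply: (@le_trans _ _ (t ^+ k * \prod_(A <- v) (u'^-1 * u' ^+ size A))); last first.
  rewrite ler_wpM2r ?prodr_ge0// => [A _|]; first by rewrite mulr_ge0 ?invr_ge0 ?exprn_ge0 ?ltW.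
  by rewrite ler_wiXn2l// ltW.
have -> : t ^+ k = \prod_(A <- v) (if (M < size A)%N then t else 1).
  by rewrite -big_mkcond /= big_const_seq -kv iter_mulr mulr1.
rewrite -big_split /= big_seq [leRHS]big_seq; apply: ler_prod => A Av.
rewrite exprn_ge0 ?(ltW u0)//=.
have := allP v1 _ Av; rewrite /pdeg; case: (size A) => [//|d] /= _.
have -> : u'^-1 * u' ^+ d.+1 = u' ^+ d by rewrite exprS mulrA mulVf ?mul1r ?gt_eqF.
have k0 : 0 <= u / u' by rewrite divr_ge0 ?ltW.
have -> : u ^+ d = (u / u') ^+ d * u' ^+ d by rewrite -exprMn divfK// gt_eqF.
rewrite ler_wpM2r ?exprn_ge0 ?(ltW u'0)//; case: ifP => Md.
  apply: le_trans hM; rewrite ler_wiXn2l//.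
  by rewrite ler_pdivrMr// mul1r.
by rewrite exprn_ile1// ler_pdivrMr// mul1r.
Qed.

End PolyWeights.

(** * Hausdorff measure and dimension *)

Section HausdorffBasics.
Context {R : realType} {T : metricType R}.
Implicit Types A B : set T.
Local Open Scope ereal_scope.

Lemma diam_ge0 A : 0 <= diam A.
Proof. by apply: ereal_sup_ubound; left. Qed.

Lemma diam_le A (r : R) : (0 <= r)%R ->
  (forall x y, A x -> A y -> (mdist x y <= r)%R) -> diam A <= r%:E.
Proof.
move=> r0 h; apply: ge_ereal_sup => _ [->|[x Ax [y Ay <-]]]; rewrite lee_fin//.
exact: h.
Qed.

Lemma le_diam A x y : A x -> A y -> (mdist x y)%:E <= diam A.
Proof. by move=> Ax Ay; apply: ereal_sup_ubound; right; exists x => //; exists y. Qed.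

Lemma hausdorff_content_ge0 s delta A : 0 <= hausdorff_content s delta A.
Proof.
apply: le_ereal_inf_tmp => _ [U _ <-]; apply: nneseries_ge0 => n _ _.
exact: poweR_ge0.
Qed.

Lemma hausdorff_measure_ge0 s A : 0 <= hausdorff_measure s A.
Proof.
apply: le_trans (hausdorff_content_ge0 s 1 A) _.
by apply: ereal_sup_ubound; exists 1%R => //=.
Qed.

Lemma hausdorff_measure_eq0P s A : hausdorff_measure s A = 0 <->
  forall delta e : R, (0 < delta)%R -> (0 < e)%R ->
  exists2 U, is_cover delta A U & \sum_(0 <= i <oo | U i != set0) (diam (U i) `^ s) <= e%:E.
Proof.
split=> [A0 delta e d0 e0|h].
  have : hausdorff_content s delta A <= 0.
    by rewrite -A0; apply: ereal_sup_ubound; exists delta.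
  move=> h; have : hausdorff_content s delta A < e%:E by rewrite (le_lt_trans h)// lte_fin.
  by move=> /ereal_inf_lt[_ [U UA <-] /ltW Ue]; exists U.
apply/eqP; rewrite eq_le hausdorff_measure_ge0 andbT.
apply: ge_ereal_sup => _ [delta /= d0 <-]; apply/lee_addgt0Pr => e e0; rewrite add0e.
have [U UA Ue] := h _ _ d0 e0; apply: le_trans Ue.
by apply: ereal_inf_lbound; exists U.
Qed.

Lemma hausdorff_dim_mono A B : A `<=` B -> hausdorff_dim A <= hausdorff_dim B.
Proof.
move=> AB; apply: ereal_inf_le_tmp => _ [s [s0 /hausdorff_measure_eq0P B0] <-].
exists s => //; split=> //; apply/hausdorff_measure_eq0P => delta e d0 e0.
have [U [BU Ud] Ue] := B0 _ _ d0 e0; exists U => //; split=> //.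
exact: subset_trans BU.
Qed.

End HausdorffBasics.

Lemma gt1_ltr_powR (R : realType) (a x y : R) : 1 < a -> x < y -> a `^ x < a `^ y.
Proof.
move=> a1 xy; have a0 : 0 < a by rewrite (lt_trans ltr01).
by rewrite /powR gt_eqF// ltr_expR ltr_pM2r// ln_gt0.
Qed.

(** * Dimension at most 1/2 *)

Section UpperBound.
Context (R : realType) (F : finFieldType).
Local Notation q := (#|F|%:R : R).
Local Notation E := (@distinct_digits R F).

(** Intersecting with [E] ensures that only words with distinct nonconstant letters give nonempty
    cylinders. *)
Definition cylinder (n : nat) (v : seq {poly F}) : set (Delta R F) :=
  [set x | E x /\ v = mkseq (fun k => digit k.+1 x) n].

Lemma distinct_digits_iter_neq0 (x : Delta R F) n : E x -> val (iter n gauss x) != 0.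
Proof. by case=> xi _; exact: irrational_iter_neq0. Qed.

Lemma cylinder_word n v : cylinder n v !=set0 ->
  [/\ size v = n, uniq v & all (fun A => 1 <= pdeg A)%N v].
Proof.
case=> x [Ex ->]; split; first by rewrite size_mkseq.
  apply/(uniqP 0); rewrite size_mkseq => i j; rewrite !inE => iN jN.
  rewrite !nth_mkseq//; case: Ex => _ h; apply: contraPP => /eqP ij.
  by apply: h => // -[/eqP]; apply/negP.
apply/allP => _ /mapP[k _ ->].
exact: (digit1_gt0 (distinct_digits_iter_neq0 k Ex)).
Qed.

Lemma diam_cylinder n v :
  (diam (cylinder n v) <= (q ^- (2 * \sum_(A <- v) pdeg A))%:E)%E.
Proof.
apply: diam_le; first by rewrite invr_ge0 exprn_ge0// ltW// q_gt0.
move=> x y [Ex vx] [Ey vy].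
have -> : \sum_(A <- v) pdeg A = \sum_(k < n) pdeg (digit k.+1 x).
  by rewrite vx big_map -[X in iota 0 X]subn0 -/(index_iota 0 n) big_mkord.
apply: ddist_cylinder => [k|k|k kn]; [exact: distinct_digits_iter_neq0..|].
have := congr1 (fun s => nth 0 s k) vx; rewrite vy.
by rewrite !nth_mkseq.
Qed.

Lemma powR_diam_cylinder (s : R) n v : 0 <= s ->
  (diam (cylinder n v) `^ s <= (\prod_(A <- v) (q `^ (- (2 * s))) ^+ pdeg A)%:E)%E.
Proof.
move=> s0; have q0 := q_gt0 R (F := F).
have : (diam (cylinder n v) `^ s <= (q ^- (2 * \sum_(A <- v) pdeg A))%:E `^ s)%E.
  by apply: gt0_ler_poweR; rewrite ?in_itv /= ?leey ?andbT ?diam_ge0 ?diam_cylinder//.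
move=> /le_trans; apply; rewrite poweR_EFin lee_fin.
rewrite prodrXr -!powR_mulrn ?powR_ge0 ?(ltW q0)// -powRN -!powRrM le_eqVlt; apply/orP; left.
by apply/eqP; congr (_ `^ _); rewrite natrM; ring.
Qed.

Lemma hausdorff_measure_distinct_digits (s : R) : 2^-1 < s ->
  hausdorff_measure s E = 0%E.
Proof.
move=> s12; apply/hausdorff_measure_eq0P => delta e d0 e0.
have q0 := q_gt0 R (F := F); have q1 := card_gt1 R (F := F).
have s0 : 0 <= s by rewrite ltW// (lt_trans _ s12)// invr_gt0.
pose u := q `^ (- (2 * s)); have u0 : 0 < u by rewrite powR_gt0.
(* This is where s > 1/2 enters. *)
have uq : u < q^-1.
  rewrite -powR_inv1 ?(ltW q0)//; apply: gt1_ltr_powR => //; lra.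
(* Below 1/q, so the weights u'^deg are summable over all polynomials; above u, so u / u' < 1 is a
   gain. *)
pose u' := (u + q^-1) / 2.
have uu' : u < u' by rewrite /u'; lra.
have u'q : u' < q^-1 by rewrite /u'; lra.
have u'0 : 0 < u' by rewrite (lt_trans u0).
have qu' : q * u' < 1 by rewrite mulrC -ltr_pdivlMr// div1r.
pose c := u'^-1 * (1 - q * u')^-1.
have c1 : 1 <= c.
  have h1 : 1 <= u'^-1 by rewrite invf_ge1// (le_trans (ltW u'q))// invf_le1// ltW.
  have h2 : 1 <= (1 - q * u')^-1.
    by rewrite invf_ge1 ?subr_gt0// gerBl mulr_ge0// ltW.
  by rewrite (le_trans h1)// ler_peMr// invr_ge0 ltW.
have c0 : 0 < c := lt_le_trans ltr01 c1.
(* With t * c = 1/2, each letter of large degree outweighs the factor [c] from summing over it and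
   still halves the cost. *)
pose t := (2 * c)^-1.
have t0 : 0 < t by rewrite invr_gt0 mulr_gt0.
have t1 : t <= 1.
  rewrite invf_le1; last exact: mulr_gt0.
  by rewrite (le_trans c1)// ler_peMl ?ler1n// ltW.
have tc : t * c = 2^-1 by rewrite /t; field; rewrite gt_eqF.
have [M hM] : exists M, (u / u') ^+ M <= t.
  apply: expr_small => //; first by rewrite divr_ge0// ltW.
  by rewrite ltr_pdivrMr// mul1r.
have cK0 K : 0 < c ^+ K by rewrite exprn_gt0.
pose K := (#|F| ^ M)%N.
have [j1 hj1] : exists j, (2^-1 : R) ^+ j <= e / c ^+ K.
  by apply: expr_small; rewrite ?invf_lt1 ?divr_gt0// ltr1n.
have [j2 hj2] : exists j, (q^-1 : R) ^+ j <= delta.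
  by apply: expr_small; rewrite ?invr_ge0 ?invf_lt1// ltW.
(* [K] bounds the number of letters without gain, [j1] brings the cost below [e] and [j2] the
   diameters below [delta]. *)
pose n := (K + (j1 + j2))%N.
(* Numbers coding no word, and words of length other than [n], give the empty set and drop out of
   the cost. *)
pose U i := oapp (cylinder n) set0 (@pickle_inv (seq {poly F}) i).
exists U; first split.
- move=> x Ex; exists (choice.pickle (mkseq (fun k => digit k.+1 x) n)) => //.
  by rewrite /U pickleK_inv.
- move=> i; rewrite /U; case: pickle_inv => [v|] /=; last first.
    by apply: diam_le => //; rewrite ltW.
  have [/eqP ->|] := boolP (cylinder n v == set0).
    by apply: diam_le => //; rewrite ltW.
  move=> /set0P/cylinder_word[vn uv v1].
  apply: le_trans (diam_cylinder n v) _; rewrite lee_fin.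
  apply: le_trans hj2; rewrite -exprVn ler_wiXn2l ?invr_ge0 ?ltW ?invf_lt1//.
  have : (n <= \sum_(A <- v) pdeg A)%N.
    rewrite -vn -sum1_size big_seq [leqRHS]big_seq; apply: leq_sum => A Av.
    exact: (allP v1).
  move=> /(leq_trans _) nS; rewrite (@leq_trans (\sum_(A <- v) pdeg A))//.
    by apply: nS; rewrite /n addnA leq_addl.
  by rewrite leq_pmull.
have wt v : cylinder n v != set0 ->
    (diam (cylinder n v) `^ s <=
     (t ^+ (n - K) * \prod_(A <- v) (u'^-1 * u' ^+ size A))%:E)%E.
  move=> /set0P/cylinder_word[vn uv v1].
  apply: le_trans (powR_diam_cylinder n v s0) _; rewrite lee_fin.
  rewrite -vn; apply: word_weight_le hM uv v1 => //; exact: ltW.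
apply: lime_le; first by apply: is_cvg_nneseries => i _ _; exact: poweR_ge0.
apply: nearW => k.
pose I := [seq i <- index_iota 0 k | U i != set0].
pose L := pmap (@pickle_inv (seq {poly F})) I.
pose W (v : seq {poly F}) := t ^+ (n - K) * \prod_(A <- v) (u'^-1 * u' ^+ size A).
have UL : (\sum_(0 <= i < k | U i != set0) (diam (U i) `^ s) <= (\sum_(v <- L) W v)%:E)%E.
  rewrite -big_filter -/I /L.
  have : all (fun i => U i != set0) I by apply/allP => i; rewrite mem_filter => /andP[].
  elim: {L}I => [|i I IHI]; first by rewrite !big_nil.
  move=> /= /andP[Ui /IHI {}IHI]; rewrite big_cons.
  move: Ui; rewrite /U; case: pickle_inv => [v|] /=; last by rewrite eqxx.
  by move=> /wt hv; rewrite big_cons EFinD leeD.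
apply: le_trans UL _.
rewrite lee_fin -big_distrr /=.
have uL : uniq L by rewrite (pmap_uniq (@pickle_invK _))// filter_uniq// iota_uniq.
have sL : all (fun v => size v == n) L.
  apply/allP => v; rewrite mem_pmap => /mapP[i]; rewrite mem_filter /U => /andP[+ _] iv.
  by rewrite -iv /= => /set0P/cylinder_word[->].
have f0 (A : {poly F}) : 0 <= u'^-1 * u' ^+ size A by rewrite mulr_ge0 ?invr_ge0 ?exprn_ge0 ?ltW.
have h := sum_words_le f0 (fun X uX => sum_weight_le u'0 qu' uX) uL sL.
apply: le_trans (ler_wpM2l (exprn_ge0 _ (ltW t0)) h) _.
rewrite -/c (_ : c ^+ n = c ^+ (n - K) * c ^+ K); last first.
  by rewrite -exprD subnK// leq_addr.
rewrite mulrA -exprMn tc -ler_pdivlMr//; apply: le_trans hj1.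
by rewrite ler_wiXn2l ?invr_ge0 ?invf_le1 ?ler1n// /n addKn leq_addr.
Qed.

Lemma hausdorff_dim_distinct_digits_le : (hausdorff_dim E <= (2^-1 : R)%:E)%E.
Proof.
apply/lee_addgt0Pr => e e0; apply: ereal_inf_lbound; exists (2^-1 + e) => //.
split; first by rewrite addr_ge0 ?invr_ge0 ?ltW.
by apply: hausdorff_measure_distinct_digits; rewrite ltrDl.
Qed.

End UpperBound.

(** * Avoiding cylinders in a finitely branching tree *)

Section GreedyBranch.
Context {R : realType} {T : eqType}.
Context (opt : nat -> seq T) (uopt : forall n, uniq (opt n))
  (opt_gt0 : forall n, (0 < size (opt n))%N).
Context (P : pred nat) (w : nat -> nat -> T) (m : nat -> nat).

Local Notation b := (fun k => (size (opt k))%:R^-1 : R).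

Definition agree (i n : nat) (a : nat -> T) := all (fun k => a k == w i k) (iota 0 n).

Definition upd (a : nat -> T) (n : nat) (t : T) := fun k => if k == n then t else a k.

(* The proportion of the branches extending the first n entries of a that lie
   in the cylinder of the first m i entries of w i. *)
Definition rel_mass (n : nat) (a : nat -> T) (i : nat) : R :=
  if P i && agree i (minn n (m i)) a then \prod_(n <= k < m i) b k else 0.

Lemma rel_mass_ge0 n a i : 0 <= rel_mass n a i.
Proof.
rewrite /rel_mass; case: ifP => // _; apply: prodr_ge0 => k _.
by rewrite invr_ge0.
Qed.

(** If the cylinder is already decided at level [n], all children carry the same mass. Otherwise at
    most one child, the one labelled [w i n], carries any; this label may be missing from [opt n],
    whence the inequality. *)
Lemma rel_mass_step n a i :
  \sum_(t <- opt n) b n * rel_mass n.+1 (upd a n t) i <= rel_mass n a i.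
Proof.
have b0 k : 0 <= b k by rewrite invr_ge0.
have agr k t : (k <= n)%N -> agree i k (upd a n t) = agree i k a.
  move=> kn; apply: eq_in_all => j; rewrite mem_iota /upd => jk.
  by rewrite ltn_eqF//; lia.
have [Pi|nPi] := boolP (P i); last first.
  rewrite big1 ?rel_mass_ge0// => t _.
  by rewrite /rel_mass (negbTE nPi) mulr0.
have [mn|nm] := leqP (m i) n.
  rewrite /rel_mass Pi /= (minn_idPr mn) (minn_idPr (leq_trans mn (leqnSn n))).
  rewrite (eq_bigr (fun=> b n * (if agree i (m i) a then 1 else 0))); last first.
    by move=> t _; rewrite agr// big_geq// (leq_trans mn).
  rewrite big_const_seq iter_addr addr0 count_predT -mulrnAl.
  have -> : b n *+ size (opt n) = 1 by rewrite -[LHS]mulr_natr mulVf// pnatr_eq0 -lt0n.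
  by rewrite mul1r big_geq.
rewrite /rel_mass Pi /= (minn_idPl (ltnW nm)) (minn_idPl nm).
have agS t : agree i n.+1 (upd a n t) = agree i n a && (t == w i n).
  by rewrite /agree -addn1 iotaD all_cat -/(agree i n (upd a n t)) agr// /= /upd eqxx andbT.
under eq_bigr do rewrite agS.
case: ifP => _ /=; last by rewrite big1// => t _; rewrite mulr0.
rewrite [leRHS]big_ltn// -big_distrr /= ler_wpM2l//.
rewrite -big_mkcond /= big_const_seq iter_addr addr0.
set Q := \prod_(_ <= _ < _) _; have Q0 : 0 <= Q by apply: prodr_ge0.
have c1 : (count (fun t => t == w i n) (opt n) <= 1)%N.
  by rewrite (count_uniq_mem (w i n) (uopt n)) leq_b1.
by rewrite -[leRHS]mulr1n ler_wpMn2l.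
Qed.

(** The weights [b n] of the children add up to 1, so if all children had total mass at least 1, so
    would their average, and then the parent. *)
Lemma rel_mass_descend n a : (\sum_(0 <= i <oo) (rel_mass n a i)%:E < 1)%E ->
  exists2 t, t \in opt n & (\sum_(0 <= i <oo) (rel_mass n.+1 (upd a n t) i)%:E < 1)%E.
Proof.
move=> h; apply: contrapT => /forall2NP nt; move: h; apply/negP; rewrite -leNgt.
have ge1 t : t \in opt n ->
    (1 <= \sum_(0 <= i <oo) (rel_mass n.+1 (upd a n t) i)%:E)%E.
  by move=> tn; have [//|/negP] := nt t; rewrite -leNgt.
have b0 : 0 <= b n by rewrite invr_ge0.
have r0 t i : (0 <= (b n)%:E * (rel_mass n.+1 (upd a n t) i)%:E)%E.
  by rewrite -EFinM lee_fin mulr_ge0 ?rel_mass_ge0.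
have h1 : (1 <= \sum_(t <- opt n) \sum_(0 <= i <oo)
    ((b n)%:E * (rel_mass n.+1 (upd a n t) i)%:E))%E.
  have -> : 1%E = (\sum_(t <- opt n) (b n)%:E)%E :> \bar R.
    rewrite sumEFin big_const_seq count_predT iter_addr addr0 -[_ *+ _]mulr_natr.
    by rewrite mulVf// pnatr_eq0 -lt0n.
  rewrite big_seq [leRHS]big_seq; apply: lee_sum => t /ge1 St.
  rewrite nneseriesZl => [|i _]; last by rewrite lee_fin rel_mass_ge0.
  by rewrite -[leLHS]mule1 lee_wpmul2l.
apply: le_trans h1 _; rewrite -nneseries_sum//.
apply: lee_nneseries => [i _ _|i _]; first exact: sume_ge0.
rewrite (eq_bigr (fun t => (b n * rel_mass n.+1 (upd a n t) i)%:E)) ?sumEFin ?lee_fin//.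
exact: rel_mass_step.
Qed.

(* Descending into a child on which the relative mass of the cylinders stays
   below 1 yields a branch that lies in none of them. *)
Lemma branch_avoiding_cylinders :
  (\sum_(0 <= i <oo) (if P i then \prod_(0 <= k < m i) b k else 0)%:E < 1)%E ->
  exists a : nat -> T, (forall n, a n \in opt n) /\
    forall i, P i -> exists2 k, (k < m i)%N & a k != w i k.
Proof.
move=> h.
(* The choice function must be total; where the mass is not below 1, any option will do. *)
have /choice[f fP] : forall na : nat * (nat -> T), exists t, t \in opt na.1 /\
    ((\sum_(0 <= i <oo) (rel_mass na.1 na.2 i)%:E < 1)%E ->
     (\sum_(0 <= i <oo) (rel_mass na.1.+1 (upd na.2 na.1 t) i)%:E < 1)%E).
  case=> n a /=; have [|nlt] := pselect (\sum_(0 <= i <oo) (rel_mass n a i)%:E < 1)%E.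
    by move=> /rel_mass_descend[t tn ht]; exists t.
  case E : (opt n) => [|t s]; first by have := opt_gt0 n; rewrite E.
  by exists t; split=> //; rewrite mem_head.
have [t0 _] : exists t0, t0 \in opt 0.
  case E : (opt 0) => [|t s]; first by have := opt_gt0 0; rewrite E.
  by exists t; rewrite mem_head.
(* The first [n] entries of [A n] are final; the others are the placeholder [t0]. *)
pose A := fix A n := if n is k.+1 then upd (A k) k (f (k, A k)) else fun=> t0.
have AS n : A n.+1 = upd (A n) n (f (n, A n)) by [].
have Alt n : (\sum_(0 <= i <oo) (rel_mass n (A n) i)%:E < 1)%E.
  elim: n => [|n IHn]; last exact: (fP (n, A n)).2.
  rewrite (_ : (fun _ => _) = fun k => \sum_(0 <= i < k) (if P i then \prod_(0 <= k < m i) b k else 0)%:E)%E//.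
  apply/funext => k; apply: eq_bigr => i _; congr EFin.
  by rewrite /rel_mass min0n andbT.
pose a n := A n.+1 n.
have aA n k : (k < n)%N -> A n k = a k.
  elim: n => // n IHn; rewrite ltnS leq_eqVlt => /predU1P[->//|kn].
  by rewrite AS /upd ltn_eqF// IHn.
exists a; split=> [n|i Pi].
  by rewrite /a AS /upd eqxx; exact: (fP (n, A n)).1.
apply: contrapT => /forall2NP nk.
have := Alt (m i); apply/negP; rewrite -leNgt.
(* A branch that followed [w i] up to depth [m i] would lie inside that cylinder, whose relative
   mass is then an empty product. *)
have -> : 1%E = (rel_mass (m i) (A (m i)) i)%:E.
  rewrite /rel_mass Pi minnn big_geq// ifT//; apply/allP => k.
  rewrite mem_iota /= => km; rewrite aA//.
  by apply: contrapT => /negP kw; have [] := nk k.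
have r0 j : (0 <= (rel_mass (m i) (A (m i)) j)%:E)%E by rewrite lee_fin rel_mass_ge0.
have := @nneseries_lim_ge R _ xpredT 0 i.+1 (fun j _ _ => r0 j).
apply: le_trans; rewrite big_nat_recr//= leeDr//; exact: sume_ge0.
Qed.

End GreedyBranch.

(** * Positive Hausdorff measure for sets of prescribed digit choices *)

Section DigitCantorSet.
Context (R : realType) {F : finFieldType}.
Local Notation q := (#|F|%:R : R).
Context (opt : nat -> seq {poly F}) (uopt : forall n, uniq (opt n))
  (opt_gt0 : forall n, (0 < size (opt n))%N).
Context (deg : nat -> nat) (deg_gt0 : forall n, (1 <= deg n)%N)
  (deg_opt : forall n A, A \in opt n -> pdeg A = deg n).

Definition digit_set : set (Delta R F) :=
  [set x | ~ is_rational (val x) /\ forall n, digit n.+1 x \in opt n].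

Definition deg_sum (n : nat) := (\sum_(k < n) deg k)%N.

(** The measure of a cylinder of order [n] under the uniform product measure. *)
Definition mass (n : nat) : R := \prod_(0 <= k < n) (size (opt k))%:R^-1.

Lemma mass_ge0 n : 0 <= mass n.
Proof. by apply: prodr_ge0 => k _; rewrite invr_ge0. Qed.

Lemma leq_deg_sum n : (n <= deg_sum n)%N.
Proof.
rewrite -[leqLHS](card_ord n) -sum1_card; exact: leq_sum.
Qed.

Lemma digit_set_separation x y n : digit_set x -> digit_set y ->
  mdist x y < q ^- (2 * deg_sum n) ->
  forall k, (k < n)%N -> digit k.+1 x = digit k.+1 y.
Proof.
move=> [xi xo] [yi yo] xyn.
apply: digit_separation => [k|k|k _|]; try exact: irrational_iter_neq0.
  by rewrite (deg_opt (xo k)) (deg_opt (yo k)).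
apply: lt_le_trans xyn _; rewrite le_eqVlt; apply/orP; left; apply/eqP.
congr ((_ ^+ (2 * _))^-1); apply: eq_bigr => k _.
by rewrite (deg_opt (xo k)).
Qed.

Lemma cf_digit_set a : (forall n, a n \in opt n) -> digit_set (cf R a).
Proof.
move=> ao; have a1 n : (1 <= pdeg (a n))%N by rewrite (deg_opt (ao n)).
by split=> [|n]; [exact: cf_irrational|rewrite digit_cf].
Qed.

(** Take [n] with [r] between the separation scales of orders n + 1 and n; hence the index shift in
    the mass hypothesis. The term [e] handles r = 0, which lies below every scale. *)
Lemma separation_depth (s C : R) : 0 <= s -> 0 <= C ->
  (forall n, mass n <= C * (q ^- (2 * deg_sum n.+1)) `^ s) ->
  (forall e, 0 < e -> exists n, mass n <= e) ->
  forall r e : R, 0 <= r -> r < 1 -> 0 < e ->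
  exists n, r < q ^- (2 * deg_sum n) /\ mass n <= C * r `^ s + e.
Proof.
move=> s0 C0 hC h0 r e r0 r1 e0; have q0 := q_gt0 R (F := F).
have q1 := card_gt1 R (F := F).
move: r0; rewrite le_eqVlt => /predU1P[<-|r0].
  have [n hn] := h0 e e0; exists n; split; first by rewrite invr_gt0 exprn_gt0.
  by rewrite (le_trans hn)// lerDr mulr_ge0// powR_ge0.
have hex : exists n, q ^- (2 * deg_sum n) <= r.
  have [n hn] : exists n, q^-1 ^+ n <= r.
    by apply: expr_small; rewrite ?invr_ge0 ?invf_lt1// ltW.
  exists n; apply: le_trans hn; rewrite -exprVn ler_wiXn2l ?invr_ge0 ?invf_le1 ?(ltW q1) ?(ltW q0)//.
  by rewrite (leq_trans (leq_deg_sum n))// leq_pmull.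
have [[|n] hn hmin] := ex_minnP hex.
  by move: hn; rewrite /deg_sum big_ord0 muln0 expr0 invr1 leNgt r1.
exists n; split.
  by rewrite ltNge; apply/negP => /hmin; rewrite ltnn.
apply: le_trans (hC n) _; rewrite -[leLHS]addr0 lerD ?(ltW e0)//.
by rewrite ler_wpM2l//; apply: ge0_ler_powR => //; rewrite nnegrE ?(ltW r0).
Qed.

(** A covering piece that meets the set does so inside one cylinder, of mass comparable to the
    diameter to the power s. If the cost is small, the cylinders have total mass below 1, and an
    avoiding branch gives an uncovered point. *)
Lemma hausdorff_measure_digit_set_neq0 (s C : R) : 0 <= s -> 0 <= C ->
  (forall n, mass n <= C * (q ^- (2 * deg_sum n.+1)) `^ s) ->
  (forall e, 0 < e -> exists n, mass n <= e) ->
  hausdorff_measure s digit_set <> 0%E.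
Proof.
move=> s0 C0 hC h0 /hausdorff_measure_eq0P.
have C40 : 0 < (4 * (C + 1))^-1 by rewrite invr_gt0 mulr_gt0// ltr_wpDl.
(* Diameters stay below 1, as [separation_depth] requires. The cost contributes mass at most 1/4 and
   the [eta i] sum to 1/2, for a total of at most 3/4. *)
move=> /(_ 2^-1 (4 * (C + 1))^-1 (_ : 0 < _) C40)[|U [cU dU] sU]; first by rewrite invr_gt0.
pose P i := `[< U i `&` digit_set !=set0 >].
pose eta i : R := 2^-1 / (2 ^ i.+1)%:R.
have eta0 i : 0 < eta i by rewrite divr_gt0 ?invr_gt0// ltr0n expn_gt0.
have /choice[g gP] : forall i, exists xn : Delta R F * nat, P i ->
    [/\ U i xn.1, digit_set xn.1,
     (diam (U i) < (q ^- (2 * deg_sum xn.2))%:E)%E &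
     ((mass xn.2)%:E <= C%:E * diam (U i) `^ s + (eta i)%:E)%E].
  move=> i; have [Pi|] := boolP (P i); last by exists (cf R (fun=> 0), 0%N).
  have [x [Ux Ex]] := asboolW Pi.
  have rfin : diam (U i) \is a fin_num.
    by rewrite ge0_fin_numE ?diam_ge0// (le_lt_trans (dU i))// ltry.
  have dE := fineK rfin.
  have := separation_depth s0 C0 hC h0 (r := fine (diam (U i))) (e := eta i).
  case; rewrite ?fine_ge0 ?diam_ge0 ?eta0//.
    by rewrite -lte_fin dE (le_lt_trans (dU i))// lte_fin invf_lt1// ltr1n.
  move=> n [h1 h2]; exists (x, n) => _; split=> //.
    by rewrite -dE lte_fin.
  by rewrite -dE poweR_EFin -EFinM -EFinD lee_fin.
have : (\sum_(0 <= i <oo) (if P i then \prod_(0 <= k < (g i).2) (size (opt k))%:R^-1 else 0 : R)%:E < 1)%E.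
  pose A i := if U i != set0 then (C%:E * diam (U i) `^ s)%E else 0%E.
  have A0 i : (0 <= A i)%E.
    by rewrite /A; case: ifP => // _; rewrite mule_ge0 ?poweR_ge0.
  apply: (@le_lt_trans _ _ (\sum_(0 <= i <oo) (A i + (eta i)%:E))%E).
    apply: lee_nneseries => [i _ _|i _].
      by rewrite lee_fin; case: ifP => // _; exact: mass_ge0.
    case: ifP => Pi; last by rewrite adde_ge0// lee_fin ltW.
    have [Ux _ _] := gP i Pi.
    by rewrite /A ifT//; apply/set0P; exists (g i).1.
  apply: le_lt_trans (epsilon_trick xpredT A0 (_ : 0 <= 2^-1)) _; first by rewrite invr_ge0.
  rewrite /A -eseries_mkcond nneseriesZl; last by move=> i _; exact: poweR_ge0.
  apply: (@le_lt_trans _ _ (C%:E * (4 * (C + 1))^-1%:E + 2^-1%:E)%E).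
    by rewrite leeD2r// lee_wpmul2l.
  rewrite -EFinM -EFinD lte_fin.
  have C10 : 0 < C + 1 by rewrite ltr_wpDl.
  have : C / (4 * (C + 1)) <= 4^-1.
    by rewrite ler_pdivrMr ?mulr_gt0// mulrA mulVf ?mul1r ?pnatr_eq0// lerDl.
  by lra.
move=> /(branch_avoiding_cylinders uopt opt_gt0 (fun i k => digit k.+1 (g i).1))[a [ao aP]].
have xa := cf_digit_set ao; have [i _ Ui] := cU _ xa.
have Pi : P i by apply/asboolP; exists (cf R a).
have [Ug Eg dg _] := gP i Pi; have [k kg /negP] := aP i Pi; apply.
have a1 n : (1 <= pdeg (a n))%N by rewrite (deg_opt (ao n)).
rewrite -(digit_cf R k a1); apply/eqP.
apply: digit_set_separation kg => //.
by rewrite -lte_fin; apply: le_lt_trans dg; exact: le_diam.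
Qed.

End DigitCantorSet.

(** * Upper limits and cardinalities of finite sets *)

Section LimsupPerturbation.
Context {R : realType}.
Implicit Types u v : (\bar R)^nat.
Local Open Scope ereal_scope.

Lemma limn_esup_inf u : limn_esup u = ereal_inf (range (esups u)).
Proof. by rewrite limn_esup_lim; apply/cvg_lim => //; exact: cvg_esups_inf. Qed.

Lemma limn_esup_le_eps u v :
  (forall e : R, (0 < e)%R -> exists N, forall n, (N <= n)%N -> u n <= v n + e%:E) ->
  limn_esup u <= limn_esup v.
Proof.
move=> uv; rewrite !limn_esup_inf; apply: le_ereal_inf_tmp => _ [n _ <-].
apply/lee_addgt0Pr => e e0; have [N hN] := uv e e0.
apply: (@le_trans _ _ (esups u (maxn n N))).
  by apply: ereal_inf_lbound; exists (maxn n N).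
apply: ge_ereal_sup => _ [k /= nk <-].
apply: le_trans (hN k _) _; first by rewrite (leq_trans _ nk)// leq_maxr.
rewrite leeD2r//; apply: ereal_sup_ubound; exists k => //=.
by rewrite (leq_trans _ nk)// leq_maxl.
Qed.

End LimsupPerturbation.

Section FsetCount.
Context {T : choiceType}.
Implicit Types (A B : set T) (s : seq T).

Lemma card_fset_set_le_cat A B s : finite_set A -> finite_set B ->
  (forall x, A x -> B x \/ x \in s) ->
  (#|` fset_set A| <= #|` fset_set B| + size s)%N.
Proof.
move=> fA fB AB; rewrite -size_cat; apply: uniq_leq_size => [|x].
  exact: fset_uniq.
rewrite mem_cat -[x \in fset_set A]/(x \in fset_set A)%fset in_fset_set// inE => /AB[Bx|->].
  by rewrite (_ : x \in _ = true)// in_fset_set// mem_set.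
by rewrite orbT.
Qed.

Lemma size_le_card_fset_set A s : finite_set A -> uniq s ->
  (forall x, x \in s -> A x) -> (size s <= #|` fset_set A|)%N.
Proof.
move=> fA us sA; apply: uniq_leq_size => // x /sA Ax.
by rewrite in_fset_set// mem_set.
Qed.

End FsetCount.

(** * Sparse positions for the inserted digits *)

Section SparseEnumeration.
Context {T : countType} (wt : T -> nat) (W : set T).

Let e (i : nat) := oapp wt 0%N (@pickle_inv T i).
(** The successor in [(e k).+1] makes the exponent strictly increasing even at weight 0, so that
    [(c i).+1] at least doubles. *)
Let c (i : nat) := (2 ^ (\sum_(0 <= k < i.+1) (e k).+1)).-1.

Let c_double i j : (i < j)%N -> (2 * (c i).+1 <= (c j).+1)%N.
Proof.
move=> ij; rewrite /c !prednK ?expn_gt0// -expnS leq_exp2l//.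
rewrite [leqRHS](@big_cat_nat _ _ _ i.+1)//=; last exact: leqW.
by rewrite -addn1 leq_add2l big_nat_recr//= addnS.
Qed.

Let e_le_c i : (e i <= c i)%N.
Proof.
rewrite /c -ltnS prednK ?expn_gt0//; apply: leq_trans (ltn_expl _ _) => //.
by rewrite ltnS big_nat_recr//= addnS -addSn leq_addl.
Qed.

(* The elements of W are placed at positions of the form 2 ^ s - 1, for a sum s
   that grows fast enough to exceed the weights. *)
Lemma sparse_enumeration : exists ins : nat -> option T,
  [/\ forall n w, ins n = Some w -> W w /\ (wt w <= n)%N,
      forall w, W w -> exists n, ins n = Some w,
      forall n n' w, ins n = Some w -> ins n' = Some w -> n = n' &
      forall n n', ins n -> ins n' -> (n < n')%N -> (2 * n.+1 <= n'.+1)%N].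
Proof.
pose Q n o := exists i w, [/\ c i = n, pickle_inv i = Some w, W w & o = Some w].
pose ins n : option T := xget None [set o | Q n o].
have insP n w : ins n = Some w ->
    [/\ c (choice.pickle w) = n & W w].
  rewrite /ins; case: xgetP => // o _ [i [w' [<- iw Ww' ->]]] [<-].
  by have := @pickle_invK T i; rewrite iw /= => ->.
have cinj i j : c i = c j -> i = j.
  by move=> cij; have [/c_double|/c_double|//] := ltngtP i j; rewrite cij; lia.
exists ins; split.
- move=> n w /insP[<- Ww]; split=> //.
  by apply: leq_trans (e_le_c _); rewrite /e pickleK_inv.
- move=> w Ww; exists (c (choice.pickle w)); rewrite /ins; case: xgetP.
    by move=> o _ [i [w' [/cinj -> + _ ->]]]; rewrite pickleK_inv.
  move=> /(_ (Some w)) []; exists (choice.pickle w), w; split=> //.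
  by rewrite pickleK_inv.
- by move=> n n' w /insP[<- _] /insP[<- _].
- move=> n n'; case En : (ins n) => [w|//] _; case En' : (ins n') => [w'|//] _.
  have [<- _] := insP _ _ En; have [<- _] := insP _ _ En'.
  have [/c_double//|h|->] := ltngtP (choice.pickle w) (choice.pickle w').
    by have := c_double h; lia.
  by rewrite ltnn.
Qed.

End SparseEnumeration.

(** * Free families and the density of the rest of [S] *)

Section FreeDigits.
Context {F : finFieldType} (S : set {poly F}).

(** The n(n+1) free coefficients are asymptotically as many as the degree, yet the family is only a
    fraction of order q^-(n+1) of the polynomials up to that degree. Distinct degrees keep the
    families disjoint. *)
Definition free_deg (n : nat) := (n.+1 * n.+1)%N.
Definition free_low (n : nat) := (n * n.+1)%N.

Definition kept (d : nat) : {poly F} := xget 0 [set A | S A /\ pdeg A = d].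

Lemma free_low_lt n : (free_low n < free_deg n)%N.
Proof. by rewrite /free_low /free_deg ltn_mul2r ltnSn. Qed.

(* The coefficient at free_low n keeps the element of S of degree free_deg n
   that has to remain a fixed digit out of free_digits n. *)
Definition free_head (n : nat) : {poly F} :=
  'X^(free_deg n) + ((kept (free_deg n))`_(free_low n) + 1) *: 'X^(free_low n).

Definition free_digits (n : nat) : seq {poly F} :=
  [seq free_head n + B | B <- polys (free_low n)].

Lemma uniq_free_digits n : uniq (free_digits n).
Proof. by rewrite map_inj_uniq ?uniq_polys//; exact: addrI. Qed.

Lemma size_free_digits n : size (free_digits n) = (#|F| ^ free_low n)%N.
Proof. by rewrite size_map size_polys. Qed.

Lemma pdeg_free_digits n A : A \in free_digits n -> pdeg A = free_deg n.
Proof.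
move=> /mapP[B]; rewrite mem_polys => Bn ->; rewrite /pdeg /free_head -addrA.
have low := free_low_lt n.
rewrite size_polyDl size_polyXn// ltnS; apply: leq_trans (size_polyD _ _) _.
rewrite geq_max (leq_trans (size_scale_leq _ _)) ?size_polyXn//.
by rewrite (leq_trans Bn)// ltnW.
Qed.

Lemma coef_free_digits n A : A \in free_digits n ->
  A`_(free_low n) = (kept (free_deg n))`_(free_low n) + 1.
Proof.
move=> /mapP[B]; rewrite mem_polys => Bn ->.
rewrite !coefD coefZ !coefXn eqxx mulr1 ltn_eqF ?free_low_lt// add0r.
by rewrite (nth_default _ Bn) addr0.
Qed.

Definition fixed_digits : set {poly F} := [set A | S A /\ forall n, A \notin free_digits n].

(** Only the family of degree [d] could contain [kept d], and its members differ from it by 1 in the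
    coefficient at [free_low n]. *)
Lemma kept_fixed d : (exists A, S A /\ pdeg A = d) ->
  fixed_digits (kept d) /\ pdeg (kept d) = d.
Proof.
move=> /(xgetPex 0)[Sk dk]; rewrite -/(kept d) in Sk dk; split=> //; split=> // n.
apply/negP => kn; have nd := pdeg_free_digits kn; rewrite dk in nd.
by have /eqP := coef_free_digits kn; rewrite nd -subr_eq0 opprD addrA subrr add0r oppr_eq0 oner_eq0.
Qed.

Lemma finite_Q N (A : set {poly F}) : finite_set (Q_ N A).
Proof.
apply: (@sub_finite_set _ _ [set` polys N.+1]); last exact: finite_seq.
by move=> B [_ /=]; rewrite mem_polys /pdeg -subn1 leq_subLR add1n.
Qed.

Lemma card_Q_nonconst_ge N : (1 <= N)%N ->
  (#|F| ^ N <= #|` fset_set (Q_ N (@nonconst_poly F))|)%N.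
Proof.
move=> N1; pose s := [seq 'X^N + B | B <- polys N] : seq {poly F}.
have <- : size s = (#|F| ^ N)%N by rewrite size_map size_polys.
apply: size_le_card_fset_set; first exact: finite_Q.
  by rewrite map_inj_uniq ?uniq_polys//; exact: addrI.
move=> _ /mapP[B + ->]; rewrite mem_polys => BN.
have E : pdeg ('X^N + B) = N by rewrite /pdeg size_polyDl size_polyXn.
by split; rewrite /nonconst_poly /= E.
Qed.

(** The exponents increase strictly and q >= 2, so each term is at least twice the one before. *)
Lemma sum_free_digits_le J :
  (\sum_(n < J.+1) #|F| ^ free_low n <= 2 * #|F| ^ free_low J)%N.
Proof.
have F1 : (1 < #|F|)%N := card_finNzRing_gt1 F.
elim: J => [|J IHJ]; first by rewrite big_ord1 leq_pmull.
rewrite big_ord_recr /= mul2n -addnn leq_add2r (leq_trans IHJ)//.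
apply: (@leq_trans (#|F| ^ (free_low J).+1)); first by rewrite expnS leq_mul2r F1 orbT.
by rewrite leq_exp2l// /free_low; lia.
Qed.

Lemma square_bracket N : exists J, (J * J <= N < J.+1 * J.+1)%N.
Proof.
elim: N => [|N [J /andP[h1 h2]]]; first by exists 0%N.
have [h|h] := ltnP N.+1 (J.+1 * J.+1); first by exists J; lia.
by exists J.+1; lia.
Qed.

(** An element of [S] of degree at most N < (J+2)^2 that is not fixed belongs to one of the families
    0, ..., J. *)
Lemma card_Q_fixed_le (Z : set {poly F}) J N : fixed_digits `<=` Z ->
  (J.+1 * J.+1 <= N < J.+2 * J.+2)%N ->
  (#|` fset_set (Q_ N S)| <= #|` fset_set (Q_ N Z)| + 2 * #|F| ^ free_low J)%N.
Proof.
move=> WZ /andP[_ NJ].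
pose s := flatten [seq free_digits n | n <- iota 0 J.+1].
apply: (@leq_trans (#|` fset_set (Q_ N Z)| + size s)).
  apply: card_fset_set_le_cat; try exact: finite_Q.
  move=> A [SA AN]; have [/existsNP[n /negP An]|h] := pselect (~ forall n, A \notin free_digits n).
    right; rewrite negbK in An; apply/flatten_mapP; exists n => //.
    rewrite mem_iota /=; move: AN; rewrite (pdeg_free_digits An) /free_deg => nN.
    by rewrite add0n ltnNge; apply/negP => Jn; nia.
  by left; split=> //; apply: WZ; split=> //; apply: contrapT.
rewrite leq_add2l size_flatten sumnE !big_map -[J.+1]subn0 -/(index_iota 0 J.+1) big_mkord.
under eq_bigr do rewrite size_free_digits.
exact: sum_free_digits_le.
Qed.

(** The lost proportion is at most 2 q^(J(J+1) - N), hence at most 2 q^-(J+1) as N >= (J+1)^2.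
    Allowing any [Z] in between covers both the digits common to a whole set and those of a single
    point. *)
Lemma upper_density_fixed (R : realType) (Z : set {poly F}) :
  fixed_digits `<=` Z -> Z `<=` S ->
  upper_density_poly R Z = upper_density_poly R S.
Proof.
move=> WZ ZS; have q0 := q_gt0 R (F := F); have q1 := card_gt1 R (F := F).
apply/eqP; rewrite eq_le; apply/andP; split; apply: limn_esup_le_eps => e e0.
  exists 0%N => N _; rewrite -EFinD lee_fin -[leLHS]addr0 lerD// ?(ltW e0)//.
  rewrite ler_wpM2r ?invr_ge0// ler_nat fsubset_leq_card//.
  by rewrite -fset_set_sub; [move=> A [/ZS]|exact: finite_Q..].
have [K hK] : exists K, (#|F|%:R : R)^-1 ^+ K <= e / 2.
  by apply: expr_small; rewrite ?invr_ge0 ?invf_lt1 ?divr_gt0// ltW.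
exists (K.+1 * K.+1)%N => N KN.
have [[|J] JN] := square_bracket N; first by move: JN KN; nia.
have KJ : (K <= J.+1)%N by nia.
have N1 : (1 <= N)%N by nia.
have hc := card_Q_nonconst_ge N1.
rewrite -EFinD lee_fin; set d := #|` fset_set (Q_ N (@nonconst_poly F))| in hc *.
have d0 : (0 : R) < d%:R by rewrite ltr0n (leq_trans _ hc)// expn_gt0 (ltnW (card_finNzRing_gt1 F)).
rewrite ler_pdivrMr// mulrDl divfK ?gt_eqF//.
have := card_Q_fixed_le WZ JN; rewrite -(ler_nat R) natrD => /le_trans; apply.
rewrite lerD2l; apply: (@le_trans _ _ (e * (#|F|%:R : R) ^+ N)); last first.
  by rewrite ler_wpM2l ?(ltW e0)// -natrX ler_nat.
rewrite natrM natrX -ler_pdivrMr ?exprn_gt0//.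
apply: (@le_trans _ _ (2 * (#|F|%:R : R)^-1 ^+ K)); last first.
  by rewrite mulrC -ler_pdivlMr.
rewrite -mulrA ler_wpM2l// exprVn ler_pdivrMr ?exprn_gt0// mulrC ler_pdivlMr ?exprn_gt0//.
rewrite -exprD ler_eXn2l//.
by move: JN => /andP[JN _]; move: KJ JN; rewrite /free_low; nia.
Qed.

End FreeDigits.

(** * The digit tree attached to [S] and its dimension *)

Section Construction.
Context (R : realType) {F : finFieldType} (S : set {poly F})
  (S_nonconst : S `<=` @nonconst_poly F).
Local Notation q := (#|F|%:R : R).
Local Notation W := (fixed_digits S).
Context (ins : nat -> option {poly F})
  (insP : forall n w, ins n = Some w -> W w /\ (pdeg w <= n)%N)
  (ins_inj : forall n n' w, ins n = Some w -> ins n' = Some w -> n = n')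
  (ins_sparse : forall n n', ins n -> ins n' -> (n < n')%N -> (2 * n.+1 <= n'.+1)%N).

Definition choices (n : nat) : seq {poly F} :=
  if ins n is Some w then [:: w] else free_digits S n.

Definition digit_deg (n : nat) : nat :=
  if ins n is Some w then pdeg w else free_deg n.

(** The base-q logarithm of the number of admissible words of length [n]. *)
Definition entropy (n : nat) : nat :=
  (\sum_(k < n) (if ins k is Some _ then 0 else free_low k))%N.

Lemma uniq_choices n : uniq (choices n).
Proof. by rewrite /choices; case: ins => //; exact: uniq_free_digits. Qed.

Lemma size_choices n :
  size (choices n) = (#|F| ^ (if ins n is Some _ then 0 else free_low n))%N.
Proof. by rewrite /choices; case: ins => //; exact: size_free_digits. Qed.

Lemma size_choices_gt0 n : (0 < size (choices n))%N.
Proof. by rewrite size_choices expn_gt0 (ltnW (card_finNzRing_gt1 F)). Qed.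

Lemma digit_deg_gt0 n : (1 <= digit_deg n)%N.
Proof.
rewrite /digit_deg; case E : (ins n) => [w|//].
by have [[/S_nonconst]] := insP E.
Qed.

Lemma pdeg_choices n A : A \in choices n -> pdeg A = digit_deg n.
Proof.
rewrite /choices /digit_deg; case: ins => [w|]; first by rewrite inE => /eqP ->.
exact: pdeg_free_digits.
Qed.

(** Two inserted digits differ by injectivity, an inserted digit lies in no free family, and two
    free families have different degrees. *)
Lemma choices_disjoint m n A : A \in choices m -> A \in choices n -> m = n.
Proof.
rewrite /choices; case Em : (ins m) => [v|]; case En : (ins n) => [w|].
- rewrite !inE => /eqP -> /eqP vw; move: En; rewrite -vw => En.
  exact: ins_inj Em En.
- by rewrite inE => /eqP -> vn; have [[_ /(_ n)/negP]] := insP Em.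
- by move=> wm; rewrite inE => /eqP Aw; have [[_ /(_ m)/negP]] := insP En; rewrite -Aw.
- move=> /pdeg_free_digits Am /pdeg_free_digits; rewrite Am /free_deg; nia.
Qed.

Lemma digit_set_distinct : digit_set choices `<=` @distinct_digits R F.
Proof.
move=> x [xi xc]; split=> // -[//|m] [//|n] _ _ mn mnE; apply: mn; congr _.+1.
by apply: (choices_disjoint (xc m)); rewrite mnE.
Qed.

Lemma mass_choices n : @mass R F choices n = q ^- entropy n.
Proof.
rewrite /mass /entropy big_mkord.
transitivity (\prod_(k < n) (q ^+ (if ins k is Some _ then 0 else free_low k))^-1).
  by apply: eq_bigr => k _; rewrite size_choices natrX.
by rewrite prodfV prodrXr.
Qed.

(** An inserted digit has degree at most its position, so every degree is at most (k+1)^2 and the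
    sum of squares bounds the total. *)
Lemma deg_sum_le n : (6 * deg_sum digit_deg n <= n * n.+1 * (2 * n + 1))%N.
Proof.
rewrite /deg_sum; elim: n => [|n IHn]; first by rewrite big_ord0.
rewrite big_ord_recr /= mulnDr.
have : (digit_deg n <= n.+1 * n.+1)%N.
  rewrite /digit_deg; case E : (ins n) => [w|//]; have [_ wn] := insP E.
  by rewrite (leq_trans wn)//; nia.
by move: IHn; set D := (\sum_(i < n) _)%N; nia.
Qed.

(* The inserted positions at least double, so the squares of those below n form
   a sum dominated by a geometric one. *)
Lemma inserted_le n : (\sum_(k < n) (if ins k is Some _ then k.+1 * k.+1 else 0) <= 2 * (n * n))%N.
Proof.
pose f k := (if ins k is Some _ then k.+1 * k.+1 else 0)%N.
rewrite -[leqLHS]/(\sum_(k < n) f k)%N.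
have [N] := ubnP n; elim: N n => // N IHN [|n] nN; first by rewrite big_ord0.
case En : (ins n) => [w|]; last first.
  by rewrite big_ord_recr /= {2}/f En addn0 (leq_trans (IHN n _))//; nia.
have h : (n.+1./2 <= n)%N by lia.
have E : (\sum_(k < n) f k = \sum_(k < n.+1./2) f k)%N.
  rewrite -(big_mkord xpredT f) -(big_mkord xpredT f) (@big_cat_nat _ _ _ n.+1./2)//=.
  rewrite [X in (_ + X)%N]big_nat [X in (_ + X)%N]big1 ?addn0// => k /andP[hk kn].
  rewrite /f; case Ek : (ins k) => [v|//].
  have := ins_sparse (n := k) (n' := n); rewrite Ek En => /(_ isT isT kn); lia.
rewrite big_ord_recr /= E {2}/f En.
have := IHN n.+1./2; rewrite (leq_ltn_trans h) // => /(_ isT).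
set Y := (\sum_(_ < _) _)%N; have := half_leq (leqnn n.+1).
have : (n.+1./2 * 2 <= n.+1)%N by lia.
by nia.
Qed.

(** Without insertions the entropy would be (n^3 - n) / 3, and by [inserted_le] the insertions cost
    at most 2 n^2. *)
Lemma entropy_ge n : (n * n * n <= 3 * entropy n + 6 * (n * n) + n)%N.
Proof.
have : (n * n * n <= n + 3 * \sum_(k < n) free_low k)%N.
  elim: n => [//|n IHn]; rewrite big_ord_recr /= /free_low mulnDr.
  by move: IHn; set D := (\sum_(i < n) _)%N; nia.
have : (\sum_(k < n) free_low k <= entropy n + 2 * (n * n))%N.
  apply: leq_trans (_ : (_ <= entropy n + \sum_(k < n) (if ins k is Some _ then k.+1 * k.+1 else 0))%N) _.
    rewrite /entropy -big_split /=; apply: leq_sum => k _.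
    by case: ins => [_|]; rewrite /free_low ?addn0// add0n leq_mul2r leqnSn orbT.
  by rewrite leq_add2l inserted_le.
lia.
Qed.

Lemma mass_choices_small (e : R) : 0 < e -> exists n, @mass R F choices n <= e.
Proof.
move=> e0; have q1 := card_gt1 R (F := F); have q0 := q_gt0 R (F := F).
have [n hn] : exists n, q^-1 ^+ n <= e.
  by apply: expr_small; rewrite ?invr_ge0 ?invf_lt1// ltW.
(* From 10 on, the cubic term of [entropy_ge] dominates, so the entropy is at least [n]. *)
exists (n + 10)%N; rewrite mass_choices; apply: le_trans hn.
rewrite -exprVn ler_wiXn2l ?invr_ge0 ?invf_le1 ?(ltW q0) ?(ltW q1)//.
have := entropy_ge (n + 10); nia.
Qed.

(** The degree sum is at most, and the entropy at least, n^3/3 up to O(n^2), so a factor u < 1 makes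
    the difference bounded above. *)
Lemma entropy_deg_sum (u : R) : 0 <= u -> u < 1 ->
  exists c : R, forall n, u * (deg_sum digit_deg n.+1)%:R - (entropy n)%:R <= c.
Proof.
move=> u0 u1; pose a := (1 - u) / 3; have a0 : 0 < a by rewrite divr_gt0 ?subr_gt0.
(* The difference is at most 4 (x+1)^2 - a x^3. For x >= 1 the square term is at most 16 x^2, which
   a x^3 absorbs once x >= 16 / a. *)
have [N hN] : exists N : nat, 16 / a <= N%:R.
  by exists (Num.truncn (16 / a)).+1; rewrite ltW// truncnS_gt.
exists (4 * (N%:R + 1) ^+ 2) => n.
have := deg_sum_le n.+1; have := entropy_ge n.
set D := deg_sum _ _; set G := entropy n.
have -> : (n.+1 * n.+2 * (2 * n.+1 + 1) = (n + 1) * (n + 2) * (2 * n + 3))%N by ring.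
rewrite -!(ler_nat R) !(natrD, natrM).
set x : R := n%:R; move=> hG hD.
have x0 : 0 <= x by [].
have G0 : u * D%:R - G%:R <= 4 * (x + 1) ^+ 2 - a * (x * x * x).
  have hD' : u * (6 * D%:R) <= u * ((x + 1) * (x + 2) * (2 * x + 3)) by rewrite ler_wpM2l.
  have hu : u * (9 * (x * x) + 13 * x + 6) <= 9 * (x * x) + 13 * x + 6.
    by rewrite ler_piMl ?(ltW u1)// !addr_ge0 ?mulr_ge0.
  have xx : 0 <= x * x by rewrite mulr_ge0.
  by rewrite /a; lra.
apply: le_trans G0 _.
have [nN|Nn] := leqP n N.
  have xN : x <= N%:R by rewrite ler_nat.
  have h1 : 4 * (x + 1) ^+ 2 <= 4 * (N%:R + 1) ^+ 2.
    by rewrite ler_wpM2l// ler_sqr ?nnegrE ?addr_ge0// lerD2r.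
  have xxx : 0 <= a * (x * x * x) by apply: mulr_ge0; [exact: ltW|rewrite !mulr_ge0].
  by rewrite (le_trans _ h1)// gerBl.
have Nx : 16 / a <= x by rewrite (le_trans hN)// ler_nat ltnW.
have x1 : 1 <= x by rewrite ler1n (leq_trans _ Nn).
have ax : 16 <= a * x by rewrite mulrC -ler_pdivrMr.
have xx : x <= x * x by rewrite ler_peMr.
have axx : 16 * (x * x) <= a * (x * x * x).
  have -> : a * (x * x * x) = a * x * (x * x) by ring.
  by rewrite ler_wpM2r// mulr_ge0.
have : 0 <= (N%:R + 1 : R) ^+ 2 by rewrite exprn_ge0// addr_ge0.
by rewrite expr2; lra.
Qed.

(** For s < 1/2, [entropy_deg_sum] with u = 2s is the base-q logarithm of the required mass bound,
    with constant q^c. *)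
Lemma hausdorff_dim_choices_ge :
  ((2^-1 : R)%:E <= hausdorff_dim (digit_set (R := R) choices))%E.
Proof.
have q1 := card_gt1 R (F := F); have q0 := q_gt0 R (F := F).
apply: le_ereal_inf_tmp => _ [s [s0 hs] <-]; rewrite lee_fin leNgt; apply/negP => s12.
have u1 : 2 * s < 1 by lra.
have [|c hc] := entropy_deg_sum _ u1; first by rewrite mulr_ge0.
apply: (hausdorff_measure_digit_set_neq0 uniq_choices size_choices_gt0
  digit_deg_gt0 pdeg_choices s0 (powR_ge0 q c) _ mass_choices_small hs) => n.
rewrite mass_choices -!powR_mulrn ?(ltW q0)// -!powRN -powRrM -powRD; last first.
  by rewrite (gt_eqF q0) implybT.
apply: ler_powR; first exact: ltW.
by have := hc n; rewrite natrM; lra.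
Qed.

End Construction.

Theorem corollary1p1 (R : realType) (F : finFieldType) (S : set {poly F})
    (hS : S `<=` @nonconst_poly F)
    (hd : (0 < upper_density_poly R S)%E) :
  (exists ES : set (Delta R F),
     [/\ ES `<=` @distinct_digits R F,
         hausdorff_dim ES = hausdorff_dim (@distinct_digits R F),
         hausdorff_dim (@distinct_digits R F) = (2^-1 : R)%:E,
         upper_density_poly R
           ((\bigcup_(n in [set n : nat | (1 <= n)%N])
               \bigcap_(x in ES) [set digit n x]) `&` S)
           = upper_density_poly R S
       & upper_density_nat R
           ((\bigcup_(n in [set n : nat | (1 <= n)%N])
               \bigcap_(x in ES) [set pdeg (digit n x)])
             `&` [set pdeg A | A in S])
           = upper_density_nat R [set pdeg A | A in S]]) /\
  hausdorff_dim
    [set x : Delta R F |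
      [/\ @distinct_digits R F x,
          upper_density_poly R
            ([set digit n x | n in [set n : nat | (1 <= n)%N]] `&` S)
            = upper_density_poly R S
        & upper_density_nat R
            ([set pdeg (digit n x) | n in [set n : nat | (1 <= n)%N]]
              `&` [set pdeg A | A in S])
            = upper_density_nat R [set pdeg A | A in S]]]
  = hausdorff_dim (@distinct_digits R F).
Proof.
have [ins [insP ins_surj ins_inj ins_sparse]] :=
  sparse_enumeration (@pdeg F) (fixed_digits S).
set E := distinct_digits; pose ES := digit_set (R := R) (choices S ins).
have ESE : ES `<=` @E R F := digit_set_distinct insP ins_inj.
have dimES : ((2^-1 : R)%:E <= hausdorff_dim ES)%E.
  exact: (hausdorff_dim_choices_ge R hS insP ins_sparse).
have dimE : hausdorff_dim (@E R F) = (2^-1 : R)%:E.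
  apply/eqP; rewrite eq_le hausdorff_dim_distinct_digits_le/=.
  exact: le_trans dimES (hausdorff_dim_mono ESE).
(* Applied to [ES] itself and to the set of points in the last claim. *)
have dim_between A : ES `<=` A -> A `<=` @E R F ->
    hausdorff_dim A = hausdorff_dim (@E R F).
  move=> ESA AE; apply/eqP; rewrite eq_le hausdorff_dim_mono//= dimE.
  exact: le_trans dimES (hausdorff_dim_mono ESA).
(* At an inserted position there is a single choice; digits are numbered from 1 and positions from
   0. *)
have fixedES w : fixed_digits S w ->
    exists2 n, (1 <= n)%N & forall x, ES x -> digit n x = w.
  move=> /ins_surj[n nw]; exists n.+1 => // x [_ /(_ n)].
  by rewrite /choices nw inE => /eqP.
(* Every degree occurring in [S] is that of a kept element, which is a fixed digit; so the sets of
   degrees themselves coincide, not merely their densities. *)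
have fixed_deg d : [set pdeg A | A in S] d ->
    exists2 n, (1 <= n)%N & forall x, ES x -> pdeg (digit n x) = d.
  move=> [A SA Ad]; have [kW kd] := kept_fixed (ex_intro _ A (conj SA Ad)).
  by have [n n1 nk] := fixedES _ kW; exists n => // x /nk ->.
have deg_cap (B : set nat) : [set pdeg A | A in S] `<=` B ->
    B `&` [set pdeg A | A in S] = [set pdeg A | A in S].
  by move=> /setIidr.
split.
  exists ES; split=> //; first exact: dim_between.
    apply: upper_density_fixed => [w wW|w []//]; split; last by case: wW.
    by have [n n1 nw] := fixedES w wW; exists n => // x /nw.
  rewrite deg_cap// => d /fixed_deg[n n1 nd]; exists n => // x /nd.
  by move=> ->.
apply: dim_between => [x xES|x []//]; split; first exact: ESE.
  apply: upper_density_fixed => [w wW|w []//]; split; last by case: wW.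
  by have [n n1 nw] := fixedES w wW; exists n => //; exact: nw.
by rewrite deg_cap// => d /fixed_deg[n n1 nd]; exists n => //; exact: nd.
Qed.
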